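(* Let $n\geq 2$. A map $\varphi\colon\mathcal{PC}^n\to\mathcal{PC}^n$ satisfies $$\varphi(K\land L)=\varphi(K)\land\varphi(L)\quad\text{and}\quad \varphi(K\lor L)=\varphi(K)\lor\varphi(L)$$ for all $K,L\in\mathcal{PC}^n$ if and only if either $\varphi$ is constant, or there exists $g\in\mathrm{GL}(n)$ such that $\varphi(K)=g(K)$ for all $K\in\mathcal{PC}^n$.
   Context: We work in Euclidean space $\mathbb{R}^n$; $o$ is the origin. A (convex) pseudo-cone is a nonempty convex set $K\subset\mathbb{R}^n$ with $o\notin K$ such that $\lambda x\in K$ for all $x\in K$ and all real $\lambda\geq 1$. Put $$\mathcal{PC}^n=\{K\subset\mathbb{R}^n: K\text{ is a closed pseudo-cone, or }K=\emptyset,\text{ or }K=\mathbb{R}^n\}.$$ Ordered by inclusion, $\mathcal{PC}^n$ is a lattice with operations $K\land L=K\cap L$, and $K\lor L=\mathrm{cl}[K,L]$ if $o\notin\mathrm{cl}[K,L]$, $K\lor L=\mathbb{R}^n$ if $o\in\mathrm{cl}[K,L]$, where $\mathrm{cl}[K,L]$ is the closure of the convex hull $[K,L]$ of $K\cup L$. $\mathrm{GL}(n)$ is the group of invertible linear maps of $\mathbb{R}^n$, and $g(K)$ is the image of $K$ under $g$. *)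

(* Defs.v *)
From HB Require Import structures.
From mathcomp Require Import all_boot all_order all_algebra.
From mathcomp Require Import all_classical all_reals all_analysis.

Set Implicit Arguments.
Unset Strict Implicit.
Unset Printing Implicit Defensive.

Import Order.TTheory GRing.Theory Num.Theory.
Import numFieldNormedType.Exports.

Local Open Scope classical_set_scope.
Local Open Scope ring_scope.

(* R^n is 'cV[R]_n. Its library topology comes from the max norm, hence is the *)
(* Euclidean one.                                                             *)
Section PseudoCones.
Variables (R : realType) (n : nat).
Implicit Types (A B K L : set 'cV[R]_n) (x y : 'cV[R]_n).

Definition convex_hull A : set 'cV[R]_n := smallest (@convex_set R 'cV[R]_n) A.

Definition pseudo_cone K : Prop :=
  [/\ K !=set0, @convex_set R 'cV[R]_n K, ~ K 0 &
      forall x (l : R), K x -> 1 <= l -> K (l *: x)].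

Definition is_PC K : Prop :=
  [\/ pseudo_cone K /\ closed K, K = set0 | K = setT].

Record PC := MkPC { PC_set :> set 'cV[R]_n; PC_setP : is_PC PC_set }.

Lemma PC_set_inj : injective PC_set.
Proof.
move=> [K PK] [L PL] /= KL; move: PK PL; rewrite KL => PK PL.
by rewrite (Prop_irrelevance PK PL).
Qed.

Definition cl_hull K L : set 'cV[R]_n := closure (convex_hull (K `|` L)).

Definition join_set K L : set 'cV[R]_n :=
  if `[< cl_hull K L 0 >] then setT else cl_hull K L.

Lemma sub_convex_hull A : A `<=` convex_hull A.
Proof. exact: sub_gen_smallest. Qed.

Lemma convex_hull_convex A : @convex_set R 'cV[R]_n (convex_hull A).
Proof.
move=> x y l; rewrite !inE => Ax Ay B [cB AB].
have := cB x y l; rewrite !inE; apply; [exact: Ax | exact: Ay].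
Qed.

Lemma closure_convex A :
  @convex_set R 'cV[R]_n A -> @convex_set R 'cV[R]_n (closure A).
Proof.
move=> cA x y l; rewrite !inE => clx cly V Vxy.
pose f (p : 'cV[R]_n * 'cV[R]_n) : 'cV[R]_n :=
  l%:num *: p.1 + (1 - l%:num) *: p.2.
have fc : {for (x, y), continuous f}.
  apply: (@cvgD R _ _ (nbhs (x, y)) _ (fun p => l%:num *: p.1)
    (fun p => (1 - l%:num) *: p.2)); apply: cvgZl_tmp.
    exact: cvg_fst.
  exact: cvg_snd.
have [[U W] /= [Ux Wy] UWV] : nbhs (x, y) (f @^-1` V) by exact: fc.
have [a [Aa Ua]] := clx _ Ux; have [b [Ab Wb]] := cly _ Wy.
exists (f (a, b)); split; last exact: (UWV (a, b)).
by have := cA a b l; rewrite !inE => /(_ Aa Ab).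
Qed.

Lemma convex_hull_scale A (l : R) : (forall x, A x -> A (l *: x)) ->
  forall x, convex_hull A x -> convex_hull A (l *: x).
Proof.
move=> Al.
suff: convex_hull A `<=` [set y | convex_hull A (l *: y)] by [].
apply: smallest_sub => [u v k|y Ay]; last first.
  by apply: sub_convex_hull; exact: Al.
rewrite !inE /= => hu hv.
have := @convex_hull_convex A (l *: u) (l *: v) k; rewrite !inE => /(_ hu hv).
by congr (convex_hull A _); rewrite /conv /= scalerDr !scalerA;
  congr (_ *: _ + _ *: _); rewrite mulrC.
Qed.

Lemma closure_scale A (l : R) : (forall x, A x -> A (l *: x)) ->
  forall x, closure A x -> closure A (l *: x).
Proof.
move=> Al x clx V Vlx.
have fc : {for x, continuous (fun y : 'cV[R]_n => l *: y)}.
  exact: scaler_continuous.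
have [y [Ay Vy]] := clx _ (fc _ Vlx).
by exists (l *: y); split => //; exact: Al.
Qed.

Lemma is_PC_scale K x (l : R) : is_PC K -> 1 <= l -> K x -> K (l *: x).
Proof. by case=> [[[_ _ _ Ks] _]|->|->] // l1 Kx; exact: Ks. Qed.

Lemma is_PC_meet K L : is_PC K -> is_PC L -> is_PC (K `&` L).
Proof.
case=> [[[K0 cK nK sK] clK]|->|->] PL.
- have [[[L0 cL nL sL] clL]|->|->] := PL.
  + have [->|KL0] := eqVneq (K `&` L) set0; first exact: Or32.
    apply: Or31; split; last exact: closedI.
    split=> [||[/nK]|x l [Kx Lx] l1] //; first exact/set0P.
      move=> x y l; rewrite !inE => -[Kx Lx] [Ky Ly]; split.
        by have := cK x y l; rewrite !inE; apply.
      by have := cL x y l; rewrite !inE; apply.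
    by split; [exact: sK | exact: sL].
  + by rewrite setI0; exact: Or32.
  + by rewrite setIT; exact: Or31.
- by rewrite set0I; exact: Or32.
- by rewrite setTI.
Qed.

Lemma is_PC_join K L : is_PC K -> is_PC L -> is_PC (join_set K L).
Proof.
move=> PK PL; rewrite /join_set; case: asboolP => [_|n0]; first exact: Or33.
have [->|H0] := eqVneq (cl_hull K L) set0; first exact: Or32.
apply: Or31; split; last exact: closed_closure.
split=> [||//|x l Hx l1]; first exact/set0P.
- exact/closure_convex/convex_hull_convex.
- apply: closure_scale Hx; apply: convex_hull_scale => y.
  by case=> [Ky|Ly]; [left | right]; exact: is_PC_scale.
Qed.

Definition PC_meet (K L : PC) : PC := MkPC (is_PC_meet (PC_setP K) (PC_setP L)).

Definition PC_join (K L : PC) : PC := MkPC (is_PC_join (PC_setP K) (PC_setP L)).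

End PseudoCones.

(* Main.v *)
(* Let phi be a non-constant endomorphism, let the ray of x <> 0 be {l x | l >= 1}.

   Injectivity.  Opposite rays join to the whole space and non-parallel rays
   are disjoint, so no ray has the image of the empty set.  If phi identified
   two elements, it would identify two rays of one direction, hence, joining
   with further rays, all rays v and l v for v outside that direction.  Take
   uncountably many directions y_t in a plane and a point p_t in the image of
   the t-th ray but not in phi(empty); some p_t is a limit of other p_t'.  The
   half-spaces through y_t contain far points of the other rays, which puts p_t
   into the image of a half-space disjoint from the ray of y_t: contradiction.
   So phi is an order embedding.

   Dimension.  Of uncountably many sets that pairwise meet in A, not all can
   have a relative interior point outside A in one and the same linear span.
   Hence dimensions of images grow strictly along a chain of simplicial cones,
   and there is only room for dim phi(C) = dim C.  In particular phi(empty) is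
   empty and, for n >= 3, rays go to rays.  For n = 2 only all but countably
   many directions are covered, and a two-dimensional image of the ray of x is
   excluded by writing x = y + z with y and z of good directions.

   Linearity.  Write phi(ray x) = ray (F x).  F maps segments into segments and
   opposite vectors to opposite directions.  If F (x / t) = F x / G x t, the
   segment property gives the Pexider equation
   G (x + y) (a + b) = p G x a + q G y b, and positivity of both G y and G (- y)
   leaves only G y t = t and p = q = 1.  So F is linear, and p is in K iff F p is
   in phi(K). *)

Require Import Defs.
From HB Require Import structures.
From mathcomp Require Import all_boot all_order all_algebra.
From mathcomp Require Import all_classical all_reals all_analysis.
From mathcomp Require Import ring lra zify.
Import Order.TTheory GRing.Theory Num.Theory.
Import numFieldNormedType.Exports.
Local Open Scope classical_set_scope.
Local Open Scope ring_scope.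
Set Implicit Arguments.
Unset Strict Implicit.
Unset Printing Implicit Defensive.

(* Makes K x meaningful for a pseudo-cone K. *)
Identity Coercion set_to_pred : set >-> Funclass.

(** * Real numbers *)

(** Bernoulli's inequality [1 + m (r - 1) <= r ^+ m]. *)
Lemma expr_unbounded (R : realType) (r c : R) : 1 < r -> exists m : nat, c <= r ^+ m.
Proof.
move=> r1; have H m : 1 + m%:R * (r - 1) <= r ^+ m.
  elim: m => [|m IH]; first by rewrite mul0r addr0 expr0.
  have h1 := ler_wpM2l (ltW (lt_trans ltr01 r1)) IH.
  have h2 := mulr_ge0 (ler0n R m) (sqr_ge0 (r - 1)).
  rewrite exprS; apply: le_trans h1; rewrite -subr_ge0 -natr1.
  by apply: le_trans h2 _; rewrite le_eqVlt; apply/orP; left; apply/eqP; ring.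
exists (Num.truncn (c / (r - 1))).+1; apply: le_trans (H _).
have r0 : 0 < r - 1 by lra.
by have := truncnS_gt (c / (r - 1)); rewrite ltr_pdivrMr //; lra.
Qed.

(** Positivity makes [c] increasing, so comparing [N s] with the neighbouring integers gives
    [N |c s - c 1 * s| <= c 1] for every [N], and the difference vanishes. *)
Lemma additive_pos_linear (R : realType) (c : R -> R) :
  (forall s, 0 < s -> 0 < c s) ->
  (forall s t, 0 < s -> 0 < t -> c (s + t) = c s + c t) ->
  forall s, 0 < s -> c s = c 1 * s.
Proof.
move=> cp cD s s0.
have c_lt x y : 0 < x -> x < y -> c x < c y.
  move=> x0 xy; have yx : 0 < y - x by rewrite subr_gt0.
  by rewrite -[y](subrK x) addrC cD // ltrDl cp.
have c_mul x (m : nat) : 0 < x -> c (m.+1%:R * x) = m.+1%:R * c x.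
  move=> x0; elim: m => [|m IH]; first by rewrite !mul1r.
  by rewrite -natr1 !mulrDl !mul1r cD ?mulr_gt0 ?ltr0n // IH.
have c1 := cp 1 ltr01.
have bound (N : nat) : `|N.+1%:R * (c s - c 1 * s)| <= c 1.
  have Ns0 : 0 < N.+1%:R * s by rewrite mulr_gt0 // ltr0n.
  have := truncnS_gt (N.+1%:R * s).
  have : (Num.truncn (N.+1%:R * s))%:R <= N.+1%:R * s by rewrite truncn_le ltW.
  set m := Num.truncn _ => lo hi.
  have up : c (N.+1%:R * s) < m.+1%:R * c 1.
    by rewrite -c_mul // mulr1; exact: c_lt.
  have down : m%:R * c 1 <= c (N.+1%:R * s).
    case: (m) lo => [|k] lo; first by rewrite mul0r ltW // cp.
    rewrite -c_mul // mulr1; move: lo; rewrite le_eqVlt => /orP [/eqP -> //|lo].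
    by apply/ltW/c_lt => //; rewrite ltr0n.
  rewrite c_mul // in up down; rewrite -natr1 in up hi.
  by rewrite ler_norml; apply/andP; split; nra.
apply/eqP; rewrite -subr_eq0; apply/eqP; apply: contrapT => /eqP D0.
have D : 0 < `|c s - c 1 * s| by rewrite normr_gt0.
have := bound (Num.truncn (c 1 / `|c s - c 1 * s|)).
rewrite normrM ger0_norm ?ler0n // -ler_pdivlMr // leNgt.
by rewrite truncnS_gt.
Qed.

(** The increment [f s = h (1 + s) - h 1] is positive and additive, hence linear with some slope
    [k]. In [u c + w b = k (b + c)], small [b] give [u c <= k c] and small [c] give [w b <= k b],
    which leaves only equality. *)
Lemma pexider_pos_linear (R : realType) (h u w : R -> R) :
  (forall s, 0 < s -> 0 < u s) -> (forall s, 0 < s -> 0 < w s) ->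
  (forall a b c, 0 < a -> 0 < b -> 0 < c -> h (a + b + c) = h a + u c + w b) ->
  exists k, forall c, 0 < c -> u c = k * c.
Proof.
move=> u0 w0 E; pose f s := h (1 + s) - h 1.
have fE b c : 0 < b -> 0 < c -> f (b + c) = u c + w b.
  by move=> b0 c0; rewrite /f addrA E //; ring.
have hE a s : 0 < a -> 0 < s -> h (a + s) = h a + f s.
  move=> a0 s0; have s2 : 0 < s / 2 by rewrite divr_gt0.
  by rewrite [in f s](splitr s) fE // [in LHS](splitr s) addrA E // addrA.
have f0 s : 0 < s -> 0 < f s.
  by move=> s0; rewrite (splitr s) fE ?addr_gt0 ?u0 ?w0 // divr_gt0.
have fD s t : 0 < s -> 0 < t -> f (s + t) = f s + f t.
  move=> s0 t0; rewrite {1}/f addrA hE ?addr_gt0 // hE //.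
  by ring.
have fk := additive_pos_linear f0 fD.
have k0 := f0 1 ltr01.
exists (f 1) => c c0.
have uw b : 0 < b -> u c + w b = f 1 * (b + c) by move=> b0; rewrite -fE // fk // addr_gt0.
have wle b : 0 < b -> w b <= f 1 * b.
  move=> b0; apply/ler_addgt0Pr => e e0; have ek : 0 < e / f 1 by rewrite divr_gt0.
  have := fE b (e / f 1) b0 ek; rewrite fk ?addr_gt0 // mulrDr.
  rewrite [f 1 * (e / _)]mulrC divfK ?gt_eqF //.
  by have := u0 _ ek; lra.
apply/eqP; rewrite eq_le; apply/andP; split; last first.
  by have := uw 1 ltr01; have := wle 1 ltr01; lra.
apply/ler_addgt0Pr => e e0; have ek : 0 < e / f 1 by rewrite divr_gt0.
have := uw _ ek; rewrite mulrDr [f 1 * (e / _)]mulrC divfK ?gt_eqF //.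
by have := w0 _ ek; lra.
Qed.

(** * Uncountable families of points *)

Lemma no_injection_to_countType (R : realType) (T : countType) (f : R -> T) :
  ~ injective f.
Proof.
move=> finj.
have : countable [set: R].
  apply/countable_injP; exists (choice.pickle \o f) => x y _ _ /=.
  by move=> /(pcan_inj choice.pickleK)/finj.
move=> cR; have : countable (`[0, 1]%classic : set R).
  by apply: sub_countable cR; exact: subset_card_le.
move/countable_lebesgue_measure0.
by rewrite lebesgue_measure_itv /= lte01 oppr0 adde0 => /eqP; rewrite eqe oner_eq0.
Qed.

Lemma norm_cV_lt (R : realType) (n : nat) (v : 'cV[R]_n) (e : R) :
  0 < e -> (forall i, `|v i 0| < e) -> `|v| < e.
Proof.
move=> e0 vi; have : ball (0 : 'cV[R]_n) e v.
  by split => // i j; rewrite ord1 /ball /= !mxE sub0r normrN.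
by rewrite mx_norm_ball /ball_ /= sub0r normrN.
Qed.

Lemma norm_coord_le (R : realType) (n : nat) (v : 'cV[R]_n) i : `|v i 0| <= `|v|.
Proof.
rewrite leNgt; apply/negP => vi.
have : ball (0 : 'cV[R]_n) `|v i 0| v by rewrite mx_norm_ball /ball_ /= sub0r normrN.
case=> _ /(_ i 0); rewrite /ball /= !mxE sub0r normrN ltxx //.
Qed.

(** An uncountable family cannot keep its points apart, even if each point chooses its own radius
    and only equal colours count. The code of [t] is a mesh finer than [e t], the colour, and the
    grid cell of [f t]. *)
Lemma close_pair (R : realType) (n : nat) (f : R -> 'cV[R]_n) (c : R -> bool)
    (e : R -> R) : (forall t, 0 < e t) ->
  exists t t', [/\ t != t', c t = c t' & `|f t' - f t| < e t].
Proof.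
move=> e0.
have [N Ne] : exists N : R -> nat, forall t, (e t)^-1 < (N t).+1%:R.
  by exists (fun t => Num.truncn (e t)^-1) => t; exact: truncnS_gt.
(* Two parameters share a code, since codes lie in a countable type. *)
pose code t := (N t, c t,
  (map_mx (fun x => Num.floor (x * (N t).+1%:R)) (f t) : 'cV[int]_n)).
apply: contrapT => H.
apply: (@no_injection_to_countType R _ code) => t t' [NN cc ff].
apply: contrapT => /eqP tt'; apply: H; exists t, t'; split => //.
apply: norm_cV_lt => // i; rewrite !mxE.
move/matrixP/(_ i 0): ff; rewrite !mxE -NN => ff.
have N0 : 0 < (N t).+1%:R :> R by rewrite ltr0n.
have : `|f t' i 0 * (N t).+1%:R - f t i 0 * (N t).+1%:R| < 1.
  have h1 := Num.Theory.floor_le (f t i 0 * (N t).+1%:R).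
  have h2 := Num.Theory.floorD1_gt (f t i 0 * (N t).+1%:R).
  have h3 := Num.Theory.floor_le (f t' i 0 * (N t).+1%:R).
  have h4 := Num.Theory.floorD1_gt (f t' i 0 * (N t).+1%:R).
  rewrite ff in h1 h2; rewrite intrD in h2 h4; rewrite ltr_norml; apply/andP; split; lra.
rewrite -mulrBl normrM (gtr0_norm N0) -ltr_pdivlMr // div1r => /lt_trans; apply.
by rewrite -[ltRHS]invrK ltf_pV2 ?posrE ?invr_gt0.
Qed.

(** * Pseudo-cones, hulls and rays *)

Section PCTheory.
Variables (R : realType) (n : nat).
Implicit Types (K L M : PC R n) (x y z v p q : 'cV[R]_n).
Local Notation V := 'cV[R]_n.

Lemma PC_eq K L : K `<=` L -> L `<=` K -> K = L.
Proof. by move=> KL LK; apply/PC_set_inj/seteqP. Qed.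

Lemma PC_0 K x : K 0 -> K x.
Proof. by case: K => S /= [[[_ _ + _] _]|->|->]. Qed.

Lemma PC_closed K : closed K.
Proof.
by case: K => S /= [[_]|->|->] //; exact: closed0.
Qed.

Lemma PC_scale K x (l : R) : 1 <= l -> K x -> K (l *: x).
Proof. exact: is_PC_scale (PC_setP K). Qed.

Lemma convexE (A : set V) : @convex_set R V A <->
  forall x y (a : R), 0 <= a <= 1 -> A x -> A y -> A (a *: x + (1 - a) *: y).
Proof.
split=> [cA x y a a01 Ax Ay|cA x y l]; last first.
  by rewrite !inE => Ax Ay; apply: cA => //; apply/andP; split.
by have := cA x y (Itv01 (andP a01).1 (andP a01).2); rewrite !inE; apply.
Qed.

Lemma PC_convex K : @convex_set R V K.
Proof. by case: K => S /= [[[_ ? _ _] _]|->|->] // x y l; rewrite !inE. Qed.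

(** The vector is [a + b] times a point of the segment between [p] and [q]. *)
Lemma PC_comb K p q (a b : R) : K p -> K q -> 0 <= a -> 0 <= b -> 1 <= a + b ->
  K (a *: p + b *: q).
Proof.
move=> Kp Kq a0 b0 ab1; have ab0 : 0 < a + b by apply: lt_le_trans ab1.
have -> : a *: p + b *: q =
    (a + b) *: ((a / (a + b)) *: p + (1 - a / (a + b)) *: q).
  rewrite scalerDr !scalerA; congr (_ *: _ + _ *: _); field; lra.
apply: PC_scale => //; have /convexE := @PC_convex K; apply => //.
by rewrite (divr_ge0 a0 (ltW ab0)) ler_pdivrMr // mul1r lerDl.
Qed.

Lemma is_PCI (A : set V) : @convex_set R V A -> closed A -> (A 0 -> A = setT) ->
  (forall x (l : R), 1 <= l -> A x -> A (l *: x)) -> is_PC A.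
Proof.
move=> cA clA A0 sA; case: (pselect (A 0)) => [/A0 ->|nA0]; first exact: Or33.
have [->|/set0P AN0] := eqVneq A set0; first exact: Or32.
by apply: Or31; split=> //; split => // x l Ax l1; exact: sA.
Qed.

Lemma is_PC_bigmeet (F : set (PC R n)) : is_PC [set x | forall K, F K -> K x].
Proof.
apply: is_PCI => [| |A0|x l l1 Ax K FK].
- apply/convexE => x y a a01 Ax Ay K FK.
  by have /convexE := @PC_convex K; apply => //; [exact: Ax|exact: Ay].
- have -> : [set x | forall K, F K -> K x] = \bigcap_(K in F) K by [].
  by apply: closed_bigI => K _; exact: PC_closed.
- by apply/seteqP; split => // x _ K FK; exact/PC_0/A0.
- exact/PC_scale/Ax.
Qed.

Definition hull (A : set V) : PC R n :=
  MkPC (is_PC_bigmeet [set K : PC R n | A `<=` K]).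

Lemma sub_hull (A : set V) : A `<=` hull A.
Proof. by move=> x Ax K; apply. Qed.

Lemma hull_subE (A : set V) K : hull A `<=` K <-> A `<=` K.
Proof. by split=> [h x /sub_hull/h //|AK x]; apply. Qed.

Lemma sub_joinl K L : K `<=` PC_join K L.
Proof.
rewrite /PC_join /join_set /= => x Kx; case: asboolP => // _.
by apply: subset_closure; apply: sub_convex_hull; left.
Qed.

Lemma sub_joinr K L : L `<=` PC_join K L.
Proof.
rewrite /PC_join /join_set /= => x Kx; case: asboolP => // _.
by apply: subset_closure; apply: sub_convex_hull; right.
Qed.

(** With [sub_joinl] and [sub_joinr] this makes the join the least upper bound, which is all that is
    used of it from here on. *)
Lemma join_subE K L M : PC_join K L `<=` M <-> K `<=` M /\ L `<=` M.
Proof.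
split=> [KLM|[KM LM]].
  by split; [exact: subset_trans (@sub_joinl K L) KLM|
             exact: subset_trans (@sub_joinr K L) KLM].
have clM : cl_hull K L `<=` M.
  rewrite [X in _ `<=` X](closure_id M).1; last exact: PC_closed.
  apply: closure_subset; apply: smallest_sub; first exact: PC_convex.
  by rewrite subUset.
rewrite /PC_join /join_set /=; case: asboolP => // /clM M0 x _.
exact: PC_0.
Qed.

Lemma join_hull (A B : set V) : PC_join (hull A) (hull B) = hull (A `|` B).
Proof.
apply: PC_eq; last first.
  by apply/hull_subE; rewrite subUset; split;
    apply: subset_trans (@sub_hull _) _; [exact: sub_joinl|exact: sub_joinr].
apply/join_subE; split; apply/hull_subE.
  exact: subset_trans (@subsetUl _ _ _) (@sub_hull _).
exact: subset_trans (@subsetUr _ _ _) (@sub_hull _).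
Qed.

(* ray 0 is the whole space. *)
Definition ray x : PC R n := hull [set x].

Lemma ray_subE x K : ray x `<=` K <-> K x.
Proof. by rewrite hull_subE sub1set inE. Qed.

Lemma ray_id x : ray x x.
Proof. exact: sub_hull. Qed.

Lemma ray_scale x (c l : R) : 0 < c -> c <= l -> ray (c *: x) (l *: x).
Proof.
move=> c0 cl; have -> : l *: x = (l / c) *: (c *: x) by rewrite scalerA divfK // gt_eqF.
by apply: PC_scale; [rewrite ler_pdivlMr ?mul1r|exact: ray_id].
Qed.

(** The segment from [x] to [- c *: x] passes through the origin, and a member containing the origin
    is the whole space. *)
Lemma join_opp_ray x (c : R) v : 0 < c -> PC_join (ray x) (ray (- c *: x)) v.
Proof.
move=> c0; apply: PC_0.
have -> : 0 = (c / (c + 1)) *: x + (1 / (c + 1)) *: (- c *: x).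
  by rewrite scalerA -scalerDl (_ : _ + _ = 0) ?scale0r //; field; lra.
apply: PC_comb; [exact/sub_joinl/ray_id|exact/sub_joinr/ray_id|..].
- by rewrite divr_ge0 //; lra.
- by rewrite divr_ge0 //; lra.
- by rewrite -mulrDl mulfV //; lra.
Qed.

Lemma is_PC0 : is_PC (@set0 V). Proof. exact: Or32. Qed.
Lemma is_PCT : is_PC (@setT V). Proof. exact: Or33. Qed.
Definition PC0 : PC R n := MkPC is_PC0.
Definition PCT : PC R n := MkPC is_PCT.

End PCTheory.

Lemma norm_cV_le (R : realType) (n : nat) (v : 'cV[R]_n) (e : R) :
  0 <= e -> (forall i, `|v i 0| <= e) -> `|v| <= e.
Proof.
move=> e0 vi; apply/ler_addgt0Pl => d d0; apply/ltW/norm_cV_lt => [|i].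
  exact: ltr_pwDl.
by rewrite (le_lt_trans (vi i)) // ltrDr.
Qed.

(** * Cones over linearly independent columns *)

Section Columns.
Variables (R : realType) (n : nat).
Local Notation V := 'cV[R]_n.

Definition colfree k (X : 'M[R]_(n, k)) := row_free X^T.

Definition colspan k (X : 'M[R]_(n, k)) : set V := [set v | exists a, v = X *m a].

Lemma colfree_linv k (X : 'M[R]_(n, k)) : colfree X ->
  exists P : 'M[R]_(k, n), P *m X = 1%:M.
Proof.
move=> Xf; exists (pinvmx X^T)^T; apply: trmx_inj.
by rewrite trmx_mul trmxK trmx1 mulmxVp.
Qed.

Lemma colfreeP k (X : 'M[R]_(n, k)) :
  colfree X <-> forall a : 'cV_k, X *m a = 0 -> a = 0.
Proof.
split=> [/colfree_linv [P PX] a Xa0|H].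
  by rewrite -[a]mul1mx -PX -mulmxA Xa0 mulmx0.
rewrite /colfree -kermx_eq0; apply/eqP/row_matrixP => i.
rewrite row0; apply: trmx_inj; rewrite trmx0; apply: H; apply: trmx_inj.
by rewrite trmx_mul trmxK trmx0 -row_mul mulmx_ker row0.
Qed.

Lemma mulmx_col_sum k (X : 'M[R]_(n, k)) (a : 'cV_k) :
  X *m a = \sum_i a i 0 *: col i X.
Proof.
apply/matrixP => i j; rewrite ord1 mxE summxE; apply: eq_bigr => l _.
by rewrite !mxE mulrC.
Qed.

Lemma mulmx_cV1 (v : V) (a : 'cV[R]_1) : v *m a = a 0 0 *: v.
Proof. by rewrite [a]mx11_scalar mul_mx_scalar mxE eqxx mulr1n. Qed.

Lemma mul_row_mx_cV k (X : 'M[R]_(n, k)) (v : V) (a : 'cV_k) (b : R) :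
  row_mx X v *m col_mx a b%:M = X *m a + b *: v.
Proof. by rewrite mul_row_col mul_mx_scalar. Qed.

Lemma colfree_rcons k (X : 'M[R]_(n, k)) (v : V) :
  colfree (row_mx X v) <-> colfree X /\ ~ colspan X v.
Proof.
split=> [/colfreeP Xv|[/colfreeP Xf vX]].
- split; [apply/colfreeP => a Xa0|case=> a va].
  + have := Xv (col_mx a 0%:M); rewrite mul_row_mx_cV scale0r addr0 => /(_ Xa0).
    by move/(congr1 usubmx); rewrite col_mxKu linear0.
  + have := Xv (col_mx a (-1)%:M); rewrite mul_row_mx_cV -va scaleN1r subrr.
    move=> /(_ erefl)/(congr1 dsubmx); rewrite col_mxKd linear0.
    by move/matrixP/(_ 0 0)/eqP; rewrite !mxE eqxx mulr1n oppr_eq0 oner_eq0.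
- apply/colfreeP => a; rewrite -[a]vsubmxK [dsubmx a]mx11_scalar mul_row_mx_cV.
  set b := dsubmx a 0 0 => E; have b0 : b = 0.
    apply: contrapT => /eqP b0; apply: vX; exists (- b^-1 *: usubmx a).
    rewrite -scalemxAr scaleNr -scalerN.
    have -> : - (X *m usubmx a) = b *: v by apply/eqP; rewrite eqr_oppLR -addr_eq0 E.
    by rewrite scalerA mulVf // scale1r.
  move: E; rewrite b0 scale0r addr0 => /Xf ->.
  by apply/matrixP => i j; rewrite !mxE; case: splitP => ? _; rewrite !mxE // mul0rn.
Qed.

Lemma exists_notin_colspan k (X : 'M[R]_(n, k)) : (k < n)%N ->
  exists v, ~ colspan X v.
Proof.
move=> kn; have : ~~ (1%:M <= X^T)%MS.
  rewrite sub1mx; apply/negP => /eqP rX.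
  by have := rank_leq_row X^T; rewrite rX leqNgt kn.
case/row_subPn => i /negP nX; exists (row i 1%:M)^T => -[a va]; apply: nX.
by apply/submxP; exists a^T; rewrite -trmx_mul -va trmxK.
Qed.

Lemma colfree_square k (X : 'M[R]_(n, k)) v : k = n -> colfree X -> colspan X v.
Proof.
move=> kn Xf; have : (v^T <= X^T)%MS.
  by apply: submx_full; rewrite /row_full (eqP Xf) kn.
case/submxP => a va; exists a^T; apply: trmx_inj.
by rewrite va trmx_mul trmxK.
Qed.

Lemma mulmx_norm_le m (A : 'M[R]_(m, n)) :
  exists2 C : R, 0 < C & forall v : V, `|A *m v| <= C * `|v|.
Proof.
pose C := \sum_i \sum_j `|A i j|.
have Ci0 i : 0 <= \sum_j `|A i j| by rewrite sumr_ge0.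
have C0 : 0 <= C by rewrite sumr_ge0.
exists (1 + C) => [|v]; first by rewrite ltr_wpDr.
have C1 : 0 <= 1 + C by rewrite addr_ge0.
apply: norm_cV_le => [|i]; first by rewrite mulr_ge0.
rewrite mxE (le_trans (ler_norm_sum _ _ _)) //.
apply: (@le_trans _ _ ((\sum_j `|A i j|) * `|v|)).
  rewrite mulr_suml; apply: ler_sum => j _.
  by rewrite normrM ler_wpM2l // norm_coord_le.
rewrite ler_wpM2r // /C (bigD1 i) //= addrA [1 + _]addrC -addrA lerDl.
by rewrite addr_ge0 // sumr_ge0.
Qed.

Lemma mulmx_continuous m (A : 'M[R]_(m, n)) : continuous (fun v : V => A *m v).
Proof.
have [C C0 AC] := mulmx_norm_le A.
move=> v S /nbhs_ballP [e /= e0 eS]; apply/nbhs_ballP.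
exists (e / C) => /= [|w]; first by rewrite divr_gt0.
rewrite mx_norm_ball /ball_ /= => vw; apply: eS.
by rewrite mx_norm_ball /ball_ /= -mulmxBr (le_lt_trans (AC _)) // mulrC -ltr_pdivlMr.
Qed.

Lemma mulmx_coord_continuous m (A : 'M[R]_(m, n)) i :
  continuous (fun v : V => (A *m v) i 0).
Proof.
move=> v; apply: (@continuous_comp _ _ _ (fun v : V => A *m v) (fun w => w i 0)).
  exact: mulmx_continuous.
exact: coord_continuous.
Qed.

Lemma closed_mulmx_ge m (A : 'M[R]_(m, n)) i (c : R) :
  closed [set v : V | c <= (A *m v) i 0].
Proof.
have /continuous_closedP := @mulmx_coord_continuous _ A i.
by move=> /(_ _ (@closed_ge _ c)).
Qed.

(** For independent columns, a simplicial cone cut off at the simplex of the columns; empty for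
    [k = 0]. *)
Definition cone k (X : 'M[R]_(n, k)) : set V :=
  [set v | exists a : 'cV_k, [/\ forall i, 0 <= a i 0, 1 <= \sum_i a i 0 & v = X *m a]].

Definition cols k (X : 'M[R]_(n, k)) : set V := [set col i X | i in setT].

Lemma is_PC_cone k (X : 'M[R]_(n, k)) : colfree X -> is_PC (cone X).
Proof.
move=> Xf; apply: is_PCI.
- apply/convexE => _ _ l /andP [l0 l1] [a [a0 a1 ->]] [b [b0 b1 ->]].
  exists (l *: a + (1 - l) *: b); split.
  + by move=> i; rewrite !mxE addr_ge0 // mulr_ge0 // subr_ge0.
  + rewrite (eq_bigr (fun i => l * a i 0 + (1 - l) * b i 0)); last by move=> i _; rewrite !mxE.
    by rewrite big_split /= -!mulr_sumr; nra.
  + by rewrite mulmxDr -!scalemxAr.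
- have [P PX] := colfree_linv Xf.
  pose one : 'rV[R]_k := const_mx 1.
  (* The left inverse [P] recovers the coefficients, so finitely many closed linear inequalities
     describe the cone. The last family says [X *m P *m v = v], that is, [v] lies in the column
     span. *)
  have -> : cone X = (\bigcap_i [set v | 0 <= (P *m v) i 0]) `&`
      [set v | 1 <= (one *m P *m v) 0 0] `&`
      (\bigcap_i ([set v | 0 <= ((X *m P - 1%:M) *m v) i 0] `&`
                  [set v | 0 <= ((1%:M - X *m P) *m v) i 0])).
    have oneE (a : 'cV_k) : (one *m a) 0 0 = \sum_i a i 0.
      by rewrite mxE; apply: eq_bigr => i _; rewrite mxE mul1r.
    apply/seteqP; split=> v.
      move=> [a [a0 a1 ->]]; split; first split.
      * by move=> i _ /=; rewrite mulmxA PX mul1mx.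
      * by rewrite /= -mulmxA [P *m _]mulmxA PX mul1mx oneE.
      * move=> i _ /=; rewrite mulmxBl mul1mx -mulmxA [P *m _]mulmxA PX mul1mx subrr.
        by rewrite mulmxBl mul1mx -mulmxA [P *m _]mulmxA PX mul1mx subrr !mxE lexx.
    move=> [[v0 v1] v2]; exists (P *m v); split.
    * by move=> i; exact: v0.
    * by rewrite -oneE mulmxA.
    * apply/matrixP => i j; rewrite ord1 mulmxA; have [/= ] := v2 i I.
      rewrite !mulmxBl !mul1mx !mxE; lra.
  apply: closedI; first apply: closedI.
  + by apply: closed_bigI => i _; exact: closed_mulmx_ge.
  + exact: closed_mulmx_ge.
  + by apply: closed_bigI => i _; apply: closedI; exact: closed_mulmx_ge.
- move=> [a [_ a1 a0]]; move/colfreeP/(_ _ (esym a0)): Xf => a00.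
  by move: a1; rewrite a00 big1 ?ler10 // => i _; rewrite mxE.
- move=> _ l l1 [a [a0 a1 ->]]; exists (l *: a); split.
  + by move=> i; rewrite mxE mulr_ge0 // (le_trans ler01).
  + rewrite (eq_bigr (fun i => l * a i 0)); last by move=> i _; rewrite !mxE.
    by rewrite -mulr_sumr mulr_ege1.
  + by rewrite scalemxAr.
Qed.

Lemma PC_cone (K : PC R n) k (X : 'M[R]_(n, k)) : cols X `<=` K -> cone X `<=` K.
Proof.
move=> XK _ [a [a0 a1 ->]]; rewrite mulmx_col_sum.
(* Induction over the sum: a partial sum [v] with total coefficient [s] vanishes if [s = 0], and
   otherwise [v / s] lies in [K]. Quantifying over [l] avoids the division. *)
have [] : 0 <= \sum_i a i 0 /\ (\sum_i a i 0 = 0 -> \sum_i a i 0 *: col i X = 0) /\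
  forall l, 1 <= l * \sum_i a i 0 -> K (l *: \sum_i a i 0 *: col i X); last first.
  by move=> _ [_ /(_ 1)]; rewrite mul1r scale1r; apply.
pose P (s : R) (v : V) := 0 <= s /\ (s = 0 -> v = 0) /\
  forall l, 1 <= l * s -> K (l *: v).
apply: (@big_ind2 _ _ P).
- by split=> //; split=> // l; rewrite mulr0 ler10.
- move=> s v t w [s0 [sv Kv]] [t0 [tw Kw]]; split; first exact: addr_ge0.
  split=> [st|l lst].
    by rewrite sv ?tw ?addr0 //; lra.
  have [s00|sn0] := eqVneq s 0.
    by rewrite sv // add0r; apply: Kw; rewrite s00 add0r in lst.
  have [t00|tn0] := eqVneq t 0.
    by rewrite tw // addr0; apply: Kv; rewrite t00 addr0 in lst.
  have s1 : 0 < s by rewrite lt_neqAle eq_sym sn0.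
  have t1 : 0 < t by rewrite lt_neqAle eq_sym tn0.
  have l0 : 0 <= l by apply: contraTT lst; rewrite -!ltNge => l0; nra.
  have -> : l *: (v + w) = (l * s) *: (s^-1 *: v) + (l * t) *: (t^-1 *: w).
    by rewrite !scalerA -!mulrA !divff // !mulr1 scalerDr.
  apply: PC_comb; rewrite -?mulrDr ?mulr_ge0 //.
    by apply: Kv; rewrite mulVf.
  by apply: Kw; rewrite mulVf.
- move=> i _; split=> //; split=> [->|l]; first by rewrite scale0r.
  by rewrite scalerA => l1; apply: PC_scale => //; apply: XK; exists i.
Qed.

Lemma mem_hull_cols k (X : 'M[R]_(n, k)) : colfree X -> hull (cols X) = cone X :> set V.
Proof.
move=> Xf; apply/seteqP; split.
  apply: (_ : hull (cols X) `<=` MkPC (is_PC_cone Xf)); apply/hull_subE.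
  move=> _ [i _ <-]; exists (delta_mx i 0); split=> [j||].
  - by rewrite mxE eqxx andbT ler0n.
  - by rewrite (bigD1 i) //= mxE !eqxx lerDl sumr_ge0 // => j _; rewrite mxE ler0n.
  - by rewrite colE.
by apply: PC_cone; exact: sub_hull.
Qed.

Lemma cols_rcons k (X : 'M[R]_(n, k)) (v : V) :
  cols (row_mx X v) = cols X `|` [set v].
Proof.
apply/seteqP; split=> w.
  move=> [i _ <-]; rewrite -[i]splitK; case: (fintype.split i) => j /=.
    by left; exists j => //; apply/matrixP => a b; rewrite [LHS]mxE [RHS]mxE row_mxEl.
  by right; apply/matrixP => a b; rewrite [LHS]mxE row_mxEr !ord1.
case=> [[i _ <-]|->].
  by exists (lshift 1 i) => //; apply/matrixP => a b; rewrite [LHS]mxE [RHS]mxE row_mxEl.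
by exists (rshift k 0) => //; apply/matrixP => a b; rewrite [LHS]mxE row_mxEr ord1.
Qed.

Lemma join_hull_cols_ray k (X : 'M[R]_(n, k)) (v : V) :
  PC_join (hull (cols X)) (ray v) = hull (cols (row_mx X v)).
Proof. by rewrite join_hull cols_rcons. Qed.

Lemma cols1 (v : V) : cols v = [set v].
Proof.
apply/seteqP; split=> w; first by move=> [i _ <-]; rewrite ord1 col_id.
by move=> ->; exists 0 => //; rewrite col_id.
Qed.

Definition indep2 (x y : V) := forall a b : R, a *: x + b *: y = 0 -> a = 0 /\ b = 0.

Lemma colfree1 (v : V) : v != 0 -> colfree v.
Proof.
move=> v0; apply/colfreeP => a; rewrite mulmx_cV1 => /eqP.
by rewrite scaler_eq0 (negbTE v0) orbF => /eqP a0; apply/matrixP => i j; rewrite !ord1 a0 mxE.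
Qed.

Lemma indep2_colfree (x y : V) : indep2 x y -> colfree (row_mx x y).
Proof.
move=> xy; apply/colfreeP => a; rewrite -[a]vsubmxK mul_row_col !mulmx_cV1.
move=> /xy [a0 b0]; rewrite [usubmx a]mx11_scalar [dsubmx a]mx11_scalar a0 b0.
by rewrite !raddf0 col_mx0.
Qed.

Lemma mem_ray (x v : V) : x != 0 -> ray x v <-> exists2 l : R, 1 <= l & v = l *: x.
Proof.
move=> x0; rewrite /ray -cols1 mem_hull_cols ?colfree1 //; split.
  by move=> [a [_ ]]; rewrite big_ord1 mulmx_cV1; exists (a 0 0).
move=> [l l1 ->]; exists l%:M; split=> [i||]; rewrite ?big_ord1 ?mulmx_cV1 ?ord1 mxE //.
by rewrite (le_trans ler01).
Qed.

Lemma mem_join2 (x y v : V) : indep2 x y -> PC_join (ray x) (ray y) v <->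
  exists a b : R, [/\ 0 <= a, 0 <= b, 1 <= a + b & v = a *: x + b *: y].
Proof.
move=> xy; rewrite -[ray x]/(hull _) -cols1 join_hull_cols_ray.
rewrite mem_hull_cols ?indep2_colfree //; split.
  move=> [a [a0 ]]; rewrite big_split_ord !big_ord1 => a1.
  rewrite -[a in row_mx _ _ *m a]vsubmxK mul_row_col !mulmx_cV1 !mxE.
  by exists (a (lshift 1 0) 0), (a (rshift 1 0) 0); split.
move=> [a [b [a0 b0 ab ->]]]; exists (col_mx a%:M b%:M); split.
- by move=> i; rewrite mxE; case: splitP => j _; rewrite ord1 mxE.
- by rewrite big_split_ord !big_ord1 col_mxEu col_mxEd !mxE.
- by rewrite mul_row_col !mulmx_cV1 !mxE.
Qed.

End Columns.

(** * Independent pairs, half-spaces and relative interior points *)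

Section Independence.
Variables (R : realType) (n : nat).
Implicit Types (K L M : PC R n) (x y z v p q : 'cV[R]_n).
Local Notation V := 'cV[R]_n.

Lemma closed_notin_segment (A : set V) p q : closed A -> ~ A p ->
  exists d : R, [/\ 0 < d, d < 1 & forall t, 0 <= t <= d -> ~ A (p + t *: q)].
Proof.
move=> clA nAp; have : nbhs p (~` A) by apply: open_nbhs_nbhs; split => //; exact: closed_openC.
move=> /nbhs_ballP [e /= e0 eA].
have q0 : 0 < 1 + `|q| by rewrite ltr_pwDl.
have d0 : 0 < e / (1 + `|q|) by rewrite divr_gt0.
(* [1 + |q|] guards against [q = 0], and 1/2 keeps [d] below 1. *)
exists (Num.min (e / (1 + `|q|)) 2^-1); split.
- by rewrite lt_min d0 /= invr_gt0.
- by rewrite gt_min invf_lt1 ?ltr1n ?orbT.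
move=> t /andP [t0]; rewrite le_min => /andP [td _]; apply: eA.
rewrite mx_norm_ball /ball_ /= opprD addrA subrr sub0r normrN normrZ ger0_norm //.
apply: (@le_lt_trans _ _ (e / (1 + `|q|) * `|q|)); first by rewrite ler_wpM2r.
by rewrite -mulrA gtr_pMr // mulrC ltr_pdivrMr // mul1r ltrDr.
Qed.

Lemma indep2_sym x y : indep2 x y -> indep2 y x.
Proof. by move=> xy a b; rewrite addrC => /xy []. Qed.

Lemma indep2_neq0l x y : indep2 x y -> x != 0.
Proof.
move=> xy; apply/eqP => x0; have [|/eqP] := xy 1 0; last by rewrite oner_eq0.
by rewrite x0 scaler0 scale0r addr0.
Qed.

Lemma indep2_neq0r x y : indep2 x y -> y != 0.
Proof. by move/indep2_sym/indep2_neq0l. Qed.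

Lemma indep2_lin x y (a b c d : R) : indep2 x y -> a * d - b * c != 0 ->
  indep2 (a *: x + b *: y) (c *: x + d *: y).
Proof.
move=> xy D s t E; have [E1 E2] : s * a + t * c = 0 /\ s * b + t * d = 0.
  by apply: xy; rewrite -E !scalerDr !scalerA !scalerDl addrACA.
split; apply: (mulIf D); rewrite mul0r.
  transitivity (d * (s * a + t * c) - c * (s * b + t * d)); first ring.
  by rewrite E1 E2 !mulr0 subrr.
transitivity (a * (s * b + t * d) - b * (s * a + t * c)); first ring.
by rewrite E1 E2 !mulr0 subrr.
Qed.

Lemma indep2_eq x y (a b c d : R) : indep2 x y ->
  a *: x + b *: y = c *: x + d *: y -> a = c /\ b = d.
Proof.
move=> xy /eqP; rewrite -subr_eq0 opprD addrACA -!scalerBl => /eqP /xy [ac bd].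
by split; apply/eqP; rewrite -subr_eq0 ?ac ?bd.
Qed.

Lemma indep2_or_multiple x y : x != 0 -> indep2 x y \/ exists c, y = c *: x.
Proof.
move=> x0; case: (pselect (exists c, y = c *: x)) => [|H]; [by right|left].
move=> a b E; have b0 : b = 0.
  apply: contrapT => /eqP b0; apply: H; exists (- (b^-1 * a)).
  rewrite scaleNr -scalerA -scalerN.
  have -> : - (a *: x) = b *: y by apply/eqP; rewrite eqr_oppLR -addr_eq0 E.
  by rewrite scalerA mulVf // scale1r.
split=> //; move: E; rewrite b0 scale0r addr0 => /eqP.
by rewrite scaler_eq0 (negbTE x0) orbF => /eqP.
Qed.

Lemma exists_indep2 x : (1 < n)%N -> x != 0 -> exists y, indep2 x y.
Proof.
move=> n1 x0; have [y xy] := exists_notin_colspan x n1; exists y.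
have [//|[c yc]] := indep2_or_multiple y x0; case: xy.
by exists c%:M; rewrite mulmx_cV1 mxE eqxx mulr1n.
Qed.

Lemma exists_neq0 : (0 < n)%N -> exists x : V, x != 0.
Proof.
case: n => // m _; exists (const_mx 1); apply/eqP => /matrixP/(_ 0 0)/eqP.
by rewrite !mxE oner_eq0.
Qed.

(** If [K] contains the origin, it is the whole space; then [L] contains some [y] and [- y], hence
    their midpoint. *)
Lemma PC_sub_neq0 K L : (0 < n)%N -> (forall x, x != 0 -> K x -> L x) -> K `<=` L.
Proof.
move=> n0 KL x; have [->|x0] := eqVneq x 0; last exact: KL.
move=> K0; have [y y0] := exists_neq0 n0.
have -> : 0 = 2^-1 *: y + 2^-1 *: (- y) by rewrite scalerN subrr.
apply: PC_comb => //; try lra.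
- by apply: KL => //; exact: PC_0.
- by apply: KL; rewrite ?oppr_eq0 //; exact: PC_0.
Qed.

Lemma rays_disjoint x y : indep2 x y -> PC_meet (ray x) (ray y) = PC0 R n.
Proof.
move=> xy; apply: PC_eq => // v [/= /(mem_ray _ (indep2_neq0l xy)) [a a1 va]].
move=> /(mem_ray _ (indep2_neq0r xy)) [b b1 vb]; exfalso.
have [] := @indep2_eq _ _ a 0 0 b xy; first by rewrite !scale0r addr0 add0r -va.
by move=> a0; lra.
Qed.

Lemma indep2_dual x y : indep2 x y -> exists f g : 'rV[R]_n,
  [/\ (f *m x) 0 0 = 1, (f *m y) 0 0 = 0, (g *m x) 0 0 = 0 & (g *m y) 0 0 = 1].
Proof.
move=> /indep2_colfree/colfree_linv [P].
rewrite -[P]vsubmxK mul_col_row scalar_mx_block => /eq_block_mx [E1 E2 E3 E4].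
exists (usubmx P), (dsubmx P).
by split; rewrite ?E1 ?E2 ?E3 ?E4 !mxE ?eqxx.
Qed.

Lemma mulmx_comb m (f : 'M[R]_(m, n)) x y (a b : R) i :
  (f *m (a *: x + b *: y)) i 0 = a * (f *m x) i 0 + b * (f *m y) i 0.
Proof. by rewrite mulmxDr -!scalemxAr mxE [X in X + _]mxE [X in _ + X]mxE. Qed.

Lemma combmx_mul m (f g : 'M[R]_(m, n)) x (a b : R) i :
  ((a *: f + b *: g) *m x) i 0 = a * (f *m x) i 0 + b * (g *m x) i 0.
Proof. by rewrite mulmxDl -!scalemxAl mxE [X in X + _]mxE [X in _ + X]mxE. Qed.

Lemma is_PC_halfspace (f : 'rV[R]_n) : is_PC [set v : V | 1 <= (f *m v) 0 0].
Proof.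
apply: is_PCI.
- apply/convexE => x y a /andP [a0 a1] /= fx fy.
  by rewrite mulmxDr -!scalemxAr !mxE in fx fy *; nra.
- exact: closed_mulmx_ge.
- by rewrite /= mulmx0 mxE ler10.
- by move=> x l l1 /= fx; rewrite -scalemxAr mxE mulr_ege1.
Qed.

Definition halfspace (f : 'rV[R]_n) : PC R n := MkPC (is_PC_halfspace f).

Lemma indep2Nr x y : indep2 x y -> indep2 x (- y).
Proof.
move=> xy; have := @indep2_lin x y 1 0 0 (-1) xy.
rewrite !scale0r scale1r scaleN1r addr0 add0r; apply.
by rewrite mul0r subr0 mul1r oppr_eq0 oner_eq0.
Qed.

Lemma indep2Z x y (a b : R) : a != 0 -> b != 0 -> indep2 x y -> indep2 (a *: x) (b *: y).
Proof.
move=> a0 b0 xy; have := @indep2_lin x y a 0 0 b xy.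
by rewrite !scale0r addr0 add0r mulr0 subr0; apply; rewrite mulf_neq0.
Qed.

Lemma mem_join2_scaled p q (s t u w : R) : indep2 p q -> 0 < s -> 0 < t ->
  PC_join (ray (s *: p)) (ray (t *: q)) (u *: p + w *: q) <->
  [/\ 0 <= u, 0 <= w & 1 <= u / s + w / t].
Proof.
move=> pq s0 t0.
have spq : indep2 (s *: p) (t *: q) by apply: indep2Z; rewrite // gt_eqF.
split=> [/(mem_join2 _ spq) [a [b [a0 b0 ab]]]|[u0 w0 uw]].
  rewrite !scalerA => /(indep2_eq pq) [-> ->].
  by split; rewrite ?mulfK ?gt_eqF // mulr_ge0 // ltW.
apply/(mem_join2 _ spq); exists (u / s), (w / t).
by split=> //; [rewrite divr_ge0 // ltW|rewrite divr_ge0 // ltW|rewrite !scalerA !divfK // gt_eqF].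
Qed.

Lemma colspanB k (X : 'M[R]_(n, k)) v w : colspan X v -> colspan X w -> colspan X (v - w).
Proof. by move=> [a ->] [b ->]; exists (a - b); rewrite mulmxBr. Qed.

Lemma hull_cols_colspan k (X : 'M[R]_(n, k)) v : colfree X -> hull (cols X) v -> colspan X v.
Proof. by move=> /mem_hull_cols -> [a [_ _ ->]]; exists a. Qed.

(* Moving y slightly towards an interior point of the cone over X does not lead
   into the closed set A. *)
Lemma relative_interior_point (A : set V) M k (X : 'M[R]_(n, k)) y :
  (0 < k)%N -> closed A -> colfree X -> cols X `<=` M -> M y -> ~ A y ->
  exists p (r : R), [/\ M p, ~ A p, 0 < r &
    forall v, `|v - p| < r -> colspan X (v - p) -> M v].
Proof.
move=> k0 clA Xf XM My nAy.
have [P PX] := colfree_linv Xf; have [C C0 PCl] := mulmx_norm_le P.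
(* All coordinates are 2, so a change by less than 1 keeps them above 1. *)
pose b : 'cV[R]_k := const_mx 2.
have [d [d0 d1 dA]] := closed_notin_segment (X *m b - y) clA nAy.
have MX (a : 'cV_k) : (forall i, 1 <= a i 0) -> M (X *m a).
  move=> a1; apply: (PC_cone XM); exists a; split=> // [i|]; first exact: le_trans (a1 i).
  rewrite (bigD1 (Ordinal k0)) //= (le_trans (a1 (Ordinal k0))) // lerDl.
  by rewrite sumr_ge0 // => i _; exact: le_trans (a1 i).
have Mp v : `|v - (y + d *: (X *m b - y))| < d / C ->
    colspan X (v - (y + d *: (X *m b - y))) -> M v.
  set w := v - _ => wd [a wa].
  have aw : a = P *m w by rewrite wa mulmxA PX mul1mx.
  (* The displacement [X *m a] is charged to the endpoint [X *m b], where it counts [d^-1]-fold; the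
     radius [d / C] keeps it below 1 in each coordinate. *)
  have -> : v = (1 - d) *: y + d *: (X *m (b + d^-1 *: a)).
    rewrite mulmxDr scalerDr -scalemxAr scalerA mulfV ?gt_eqF // scale1r -wa /w.
    rewrite scalerBr scalerBl scale1r !opprD opprK.
    apply/matrixP => i j; rewrite !mxE; ring.
  apply: PC_comb => //; [|by rewrite subr_ge0 ltW|exact: ltW|by rewrite subrK].
  apply: MX => i; rewrite !mxE.
  have : `|a i 0| < d.
    by rewrite (le_lt_trans (norm_coord_le _ _)) // aw (le_lt_trans (PCl _)) // mulrC -ltr_pdivlMr.
  rewrite ltr_norml => /andP [ad _].
  have : - 1 < d^-1 * a i 0 by rewrite mulrC ltr_pdivlMr // mulN1r.
  lra.
exists (y + d *: (X *m b - y)), (d / C); split=> //.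
- by apply: Mp; rewrite subrr ?normr0 ?divr_gt0 //; exists 0; rewrite mulmx0.
- by apply: dA; rewrite lexx (ltW d0).
- by rewrite divr_gt0.
Qed.

Lemma PCT_sub_join_opp x : PCT R n `<=` PC_join (ray x) (ray (- x)).
Proof.
by move=> v _; have := @join_opp_ray R n x 1 v ltr01; rewrite scaleN1r.
Qed.

Lemma PC0_sub K : PC0 R n `<=` K.
Proof. by []. Qed.

End Independence.

(** * Non-constant endomorphisms are order embeddings *)

Section Endomorphism.
Variables (R : realType) (n : nat) (phi : PC R n -> PC R n).
Hypothesis n_gt1 : (1 < n)%N.
Hypothesis phiI : forall K L, phi (PC_meet K L) = PC_meet (phi K) (phi L).
Hypothesis phiU : forall K L, phi (PC_join K L) = PC_join (phi K) (phi L).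
(* Excludes exactly the constant maps. *)
Hypothesis phiN : ~ (phi (PCT R n) `<=` phi (PC0 R n)).
Implicit Types (K L M : PC R n) (x y z v p q : 'cV[R]_n).
Local Notation V := 'cV[R]_n.

Lemma phi_mono K L : K `<=` L -> phi K `<=` phi L.
Proof.
move=> KL; have <- : PC_meet K L = K.
  by apply: PC_eq => [x []|x Kx] //; split=> //; exact: KL.
by rewrite phiI => x [].
Qed.

Lemma phi_meet_sub K L M v : PC_meet K L `<=` M -> phi K v -> phi L v -> phi M v.
Proof. by move=> KLM Kv Lv; apply: (phi_mono KLM); rewrite phiI; split. Qed.

Lemma phi_join_sub K L M : phi K `<=` M -> phi L `<=` M -> phi (PC_join K L) `<=` M.
Proof. by move=> KM LM; rewrite phiU; apply/join_subE. Qed.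

(** Otherwise [ray (- x)] alone would have the image of the whole space. A ray independent of [x] is
    disjoint from it and would have the image of the empty set too; two opposite rays of this kind
    contradict [phiN]. *)
Lemma phi_ray_nbot x : x != 0 -> exists v, phi (ray x) v /\ ~ phi (PC0 R n) v.
Proof.
move=> x0; apply: contrapT => H; apply: phiN.
have xe : phi (ray x) `<=` phi (PC0 R n).
  by move=> v xv; apply: contrapT => ve; apply: H; exists v.
have [y xy] := exists_indep2 n_gt1 x0.
have TNx : phi (PCT R n) `<=` phi (ray (- x)).
  apply: subset_trans (phi_mono (PCT_sub_join_opp x)) _.
  by apply: phi_join_sub => //; apply: subset_trans xe (phi_mono (@PC0_sub _ _ _)).
have ze z : indep2 x z -> phi (ray z) `<=` phi (PC0 R n).
  move=> xz v zv; apply: (phi_meet_sub _ zv (TNx _ (phi_mono _ zv))) => //.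
  by rewrite rays_disjoint //; exact/indep2Nr/indep2_sym.
apply: subset_trans (phi_mono (PCT_sub_join_opp y)) _.
by apply: phi_join_sub; apply: ze => //; exact: indep2Nr.
Qed.

(* Shrinking a ray through x moves the point where the segment [x, y] meets the
   ray through v = (x + y) / 2. *)
Lemma phi_ray_shrink x (s : R) v : 1 < s -> phi (ray x) `<=` phi (ray (s *: x)) ->
  indep2 x v -> phi (ray v) `<=` phi (ray (2 * s / (1 + s) *: v)).
Proof.
move=> s1 xs xv; set r := _ / _.
have r0 : 0 < r by rewrite divr_gt0 //; lra.
pose y := 2 *: v - x.
have vE : v = 2^-1 *: x + 2^-1 *: y.
  by rewrite /y scalerBr scalerA mulVf ?pnatr_eq0 // scale1r addrC subrK.
have xy : indep2 x y.
  have := @indep2_lin R n x v 1 0 (-1) 2 xv; rewrite mul0r subr0 mul1r pnatr_eq0.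
  by rewrite scale1r scale0r addr0 scaleN1r addrC; apply.
clearbody y; pose J := PC_join (ray (s *: x)) (ray y).
have sxy : indep2 (s *: x) y.
  have := @indep2_lin R n x y s 0 0 1 xy; rewrite mul0r subr0 mulr1 scale1r !scale0r.
  by rewrite addr0 add0r; apply; lra.
have vJ : phi (ray v) `<=` phi J.
  apply: (@subset_trans _ (phi (PC_join (ray x) (ray y)))).
    apply: phi_mono; apply/ray_subE/(mem_join2 _ xy).
    by exists 2^-1, 2^-1; split => //; lra.
  apply: phi_join_sub; last by apply: phi_mono; exact: sub_joinr.
  apply: subset_trans xs _; apply: phi_mono; exact: sub_joinl.
move=> w vw; apply: (phi_meet_sub _ vw (vJ _ vw)) => u [].
move=> /(mem_ray _ (indep2_neq0r xv)) [l l1 ul].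
move=> /(mem_join2 _ sxy) [a [b [a0 b0 ab]]]; rewrite scalerA => uab.
have [|la lb] := @indep2_eq R n x y (l / 2) (l / 2) (a * s) b xy.
  by rewrite -uab ul vE scalerDr !scalerA.
(* [l / 2 = a s = b] turns [a + b >= 1] into [l (1 + s) >= 2 s]. *)
have lr : r <= l.
  rewrite /r ler_pdivrMr; last lra.
  nra.
by rewrite ul; exact: ray_scale.
Qed.

(** The factor [r = 2 s / (1 + s)] exceeds 1 and does not depend on [v], so the shrinking can be
    repeated along the ray until it passes [l]. *)
Lemma phi_ray_shrink_far x (s : R) v (l : R) : 1 < s ->
  phi (ray x) `<=` phi (ray (s *: x)) -> indep2 x v -> 0 < l ->
  phi (ray v) `<=` phi (ray (l *: v)).
Proof.
move=> s1 xs xv l0; pose r := 2 * s / (1 + s).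
have r1 : 1 < r by rewrite /r ltr_pdivlMr; lra.
have [m lm] := expr_unbounded l r1.
apply: (@subset_trans _ (phi (ray (r ^+ m *: v)))); last first.
  by apply: phi_mono; apply/ray_subE; exact: ray_scale.
elim: m {lm} => [|m IH]; first by rewrite expr0 scale1r.
apply: subset_trans IH _; rewrite exprS -scalerA; apply: phi_ray_shrink s1 xs _.
have := @indep2_lin R n x v 1 0 0 (r ^+ m) xv.
rewrite scale1r !scale0r addr0 add0r mul0r subr0 mul1r; apply.
by rewrite expf_neq0 //; lra.
Qed.

Lemma phi_ray_not_shrink x (s : R) : x != 0 -> 1 < s ->
  ~ (phi (ray x) `<=` phi (ray (s *: x))).
Proof.
move=> x0 s1 xs; have [u xu] := exists_indep2 n_gt1 x0.
have [f [g [fx fu gx gu]]] := indep2_dual xu.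
pose y (t : R) := u + t *: x.
have xy t : indep2 x (y t).
  have := @indep2_lin R n x u 1 0 t 1 xu; rewrite mul0r subr0 mul1r oner_eq0.
  by rewrite scale1r scale0r addr0 scale1r addrC; apply.
have yE t l : l *: y t = l *: u + (l * t) *: x by rewrite scalerDr scalerA.
(* Far points of the ray of y t' lie in H sg t iff t' is on the side sg of t. *)
pose H (sg t : R) := halfspace (sg *: f + (- (sg * t)) *: g).
have HE sg t t' l : H sg t (l *: y t') = (1 <= sg * (l * (t' - t))) :> Prop.
  rewrite /H /= combmx_mul yE !mulmx_comb fx fu gx gu; congr (is_true (_ <= _)); ring.
have /boolp.choice [p yp] t : exists v, phi (ray (y t)) v /\ ~ phi (PC0 R n) v.
  exact/phi_ray_nbot/(indep2_neq0r (xy t)).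
(* The functional of [H sg t] vanishes on [y t], so the half-space misses the ray of [y t]. *)
have Hp sg t : ~ phi (H sg t) (p t).
  move=> Hp; apply: (yp t).2; apply: (phi_meet_sub _ (yp t).1 Hp) => v [].
  move=> /(mem_ray _ (indep2_neq0r (xy t))) [l l1 ->].
  by rewrite -[PC_set _ _]/(H sg t (l *: y t)) HE subrr !mulr0 ler10.
(* By shrinking, the ray of [y t'] may start where it enters [H sg t], at the factor
   [(sg * (t' - t))^-1]. *)
have phiH sg t t' : 0 < sg * (t' - t) -> phi (ray (y t')) `<=` phi (H sg t).
  move=> st; apply: subset_trans (phi_ray_shrink_far s1 xs (xy t') _) _.
    by rewrite -invr_gt0 in st; exact: st.
  apply: phi_mono; apply/ray_subE.
  by rewrite -[PC_set _ _]/(H sg t _) HE mulrCA mulVf ?gt_eqF.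
have /boolp.choice [e He] t : exists e : R, 0 < e /\
    forall v, `|v - p t| < e -> ~ phi (H 1 t) v /\ ~ phi (H (-1) t) v.
  have : nbhs (p t) (~` phi (H 1 t) `&` ~` phi (H (-1) t)).
    apply: open_nbhs_nbhs; split; last by split; exact: Hp.
    by apply: openI; apply: closed_openC; exact: PC_closed.
  move=> /nbhs_ballP [e /= e0 eH]; exists e; split=> // v ve.
  by apply: eH; rewrite mx_norm_ball /ball_ /= distrC.
(* [p t'] is too close to [p t] to lie in either image, but the sign of [t' - t] puts it into one of
   them. *)
have [t [t' [tt' _ ptt']]] := close_pair p (fun=> true) (fun t => (He t).1).
have [H1 H2] := (He t).2 _ ptt'.
move: tt'; rewrite neq_lt => /orP [] lt_tt'.
  by apply: H1; apply: phiH (yp t').1; rewrite mul1r subr_gt0.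
by apply: H2; apply: phiH (yp t').1; rewrite mulN1r opprB subr_gt0.
Qed.

(** If [x] in [K] is not in the closed set [L], then [ray x] meets [L] only from some [(1 + d) *: x]
    on, and the image of [ray x] would shrink to that of [ray ((1 + d) *: x)]. *)
Lemma phi_order_embedding K L : phi K `<=` phi L -> K `<=` L.
Proof.
move=> KL; apply: PC_sub_neq0 (ltnW n_gt1) _ => x x0 Kx.
apply: contrapT => nLx.
have [d [d0 d1 dL]] := closed_notin_segment x (@PC_closed R n L) nLx.
have d1' : 1 < 1 + d by rewrite ltrDl.
apply: (phi_ray_not_shrink x0 d1') => v xv.
have Kv : phi L v by apply: KL; apply: phi_mono xv; exact/ray_subE.
apply: (phi_meet_sub _ xv Kv) => u [/(mem_ray _ x0) [l l1 ul] Lu].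
have dl : 1 + d <= l.
  rewrite leNgt; apply/negP => ld; apply: (dL (l - 1)).
    by rewrite subr_ge0 l1 /=; lra.
  by rewrite scalerBl scale1r addrC subrK -ul.
by rewrite ul; apply: ray_scale; lra.
Qed.

(** * Images of rays are rays *)

(* Adjoining the uncountably many vectors u + t *: w to X must raise the dimension
   of the image, but cannot give all images full dimension. *)
Lemma phi_hull_cols_dim_step a b (X : 'M[R]_(n, a)) (Y : 'M[R]_(n, b)) :
  (a + 2 <= n)%N -> b = a.+1 -> colfree X -> colfree Y ->
  (a + 2)%N = n \/ (forall (X' : 'M[R]_(n, a + 1)) (Y' : 'M[R]_(n, b + 1)),
    colfree X' -> colfree Y' -> ~ (cols Y' `<=` phi (hull (cols X')))) ->
  ~ (cols Y `<=` phi (hull (cols X))).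
Proof.
move=> an ba Xf Yf IH YA.
have [|u uX] := @exists_notin_colspan R n a X; first lia.
have Xu : colfree (row_mx X u) by apply/colfree_rcons.
have [|w wXu] := @exists_notin_colspan R n (a + 1) (row_mx X u); first lia.
have uwX (s t : R) : colspan X (s *: u + t *: w) -> s = 0 /\ t = 0.
  move=> [c cE]; have t0 : t = 0.
    apply: contrapT => /eqP t0; apply: wXu.
    exists (t^-1 *: col_mx c (- s)%:M).
    rewrite -scalemxAr mul_row_mx_cV -cE scaleNr [s *: u + _]addrC addrK.
    by rewrite scalerA mulVf // scale1r.
  split=> //; apply: contrapT => /eqP s0; apply: uX; exists (s^-1 *: c).
  by rewrite -scalemxAr -cE t0 scale0r addr0 scalerA mulVf // scale1r.
pose v (t : R) := u + t *: w.
have Xv t : colfree (row_mx X (v t)).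
  apply/colfree_rcons; split=> // vX; have [] := uwX 1 t; first by rewrite scale1r.
  by move/eqP; rewrite oner_eq0.
pose K t := hull (cols (row_mx X (v t))).
have XK t : hull (cols X) `<=` K t by rewrite /K -join_hull_cols_ray; exact: sub_joinl.
(* Modulo the span of [X], comparing coefficients at [u] and [w] gives [be = be'] and
   [be t = be' t'], hence [be = 0]. *)
have KK t t' : t != t' -> PC_meet (K t) (K t') `<=` hull (cols X).
  move=> tt' x [xt xt']; move: xt xt'; rewrite /K mem_hull_cols //.
  rewrite mem_hull_cols // => -[c [c0 c1 ->]] [c' [c0' c1']].
  have split_last (d : 'cV[R]_(a + 1)) : exists e (be : R), d = col_mx e be%:M.
    by exists (usubmx d), (dsubmx d 0 0); rewrite -mx11_scalar vsubmxK.
  have [e [be eE]] := split_last c; have [e' [be' eE']] := split_last c'.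
  rewrite eE eE' !mul_row_mx_cV => E.
  have [] := uwX (be - be') (be * t - be' * t').
    exists (e' - e); rewrite mulmxBr.
    have -> : (be - be') *: u + (be * t - be' * t') *: w = be *: v t - be' *: v t'.
      by rewrite /v !scalerDr !scalerA !scalerBl opprD addrACA.
    by apply/eqP; rewrite subr_eq addrAC eq_sym subr_eq -E addrC.
  move=> /eqP; rewrite subr_eq0 => /eqP <- /eqP.
  rewrite -mulrBr mulf_eq0 subr_eq0 (negbTE tt') orbF => /eqP b0.
  rewrite b0 scale0r addr0 mem_hull_cols //; exists e; split=> //.
    by move=> i; have := c0 (lshift 1 i); rewrite eE col_mxEu.
  move: c1; rewrite eE big_split_ord /= big_ord1 col_mxEd b0.
  rewrite (eq_bigr (fun i => e i 0)) => [|i _]; last by rewrite col_mxEu.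
  by rewrite [X in _ + X]mxE mul0rn addr0.
pose A := phi (hull (cols X)).
have KA t : exists2 y, phi (K t) y & ~ A y.
  apply: contrapT => H.
  have /phi_order_embedding KX : phi (K t) `<=` A.
    by move=> y Ky; apply: contrapT => nAy; apply: H; exists y.
  have : colspan X (v t).
    apply: hull_cols_colspan => //; apply: KX.
    by rewrite /K -join_hull_cols_ray; exact/sub_joinr/ray_id.
  by have /colfree_rcons [] := Xv t.
(* The data are a point of [phi (K t)] outside [A], a radius and a flag telling whether the image
   stays in the span of [Y]. The point is interior relative to that span, or else to the whole
   space. *)
have /boolp.choice [s Hs] t : exists s : V * R * bool,
    [/\ phi (K t) s.1.1, ~ A s.1.1, 0 < s.1.2, s.2 -> phi (K t) `<=` colspan Y &
      forall z, `|z - s.1.1| < s.1.2 -> (s.2 -> colspan Y z) -> phi (K t) z].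
  have [y Ky nAy] := KA t.
  have YK : cols Y `<=` phi (K t) by apply: subset_trans YA (phi_mono (XK t)).
  case: (pselect (phi (K t) `<=` colspan Y)) => [KY|].
    have [|p [r [Kp nAp r0 pr]]] :=
      relative_interior_point _ (@PC_closed _ _ A) Yf YK Ky nAy; first by rewrite ba.
    exists (p, r, true); split=> //= z zp /(_ isT) zY; apply: pr => //.
    exact/colspanB/KY.
  move=> nKY; have [z Kz nYz] : exists2 z, phi (K t) z & ~ colspan Y z.
    by apply: contrapT => H; apply: nKY => z Kz; apply: contrapT => nz; apply: H; exists z.
  have Yz : colfree (row_mx Y z) by apply/colfree_rcons.
  have YzK : cols (row_mx Y z) `<=` phi (K t).
    by rewrite cols_rcons subUset; split=> // _ ->.
  (* [Y] and [z] are [a + 2] independent columns in the image of a hull of [a + 1]. This is excluded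
     by [IH] unless [a + 2 = n], and then they span the whole space. *)
  case: IH => [an2|IH]; last by case: (IH _ _ (Xv t) Yz).
  have [|p [r [Kp nAp r0 pr]]] :=
    relative_interior_point _ (@PC_closed _ _ A) Yz YzK Ky nAy; first by rewrite addn1.
  exists (p, r, false); split=> //= q qp _; apply: pr => //.
  by apply: colfree_square Yz; lia.
have s0 t : 0 < (s t).1.2 by case: (Hs t).
(* With equal flags, the nearby point of [t'] lies in [phi (K t)] too, hence in the image of the
   meet, which is inside [A]. *)
have [t [t' [tt' ctt' ptt']]] := close_pair (fun t => (s t).1.1) (fun t => (s t).2) s0.
have [Kp' nAp' _ KY' _] := Hs t'; have [_ _ _ _ H] := Hs t.
apply: nAp'; apply: (phi_meet_sub (KK _ _ tt') _ Kp'); apply: H => //.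
by rewrite ctt' => /KY'; apply.
Qed.

(** Descending induction on [a], with [m = n - 2 - a]. Rays, where [a = 1], are covered only from
    [n = 3] on. *)
Lemma phi_hull_cols_dim m a b (X : 'M[R]_(n, a)) (Y : 'M[R]_(n, b)) :
  (m + a + 2)%N = n -> b = a.+1 -> colfree X -> colfree Y ->
  ~ (cols Y `<=` phi (hull (cols X))).
Proof.
elim: m a b X Y => [|m IH] a b X Y man ba Xf Yf.
  by apply: phi_hull_cols_dim_step => //; [lia|left].
apply: phi_hull_cols_dim_step => //; first lia.
right=> X' Y' Xf' Yf'; apply: IH => //; lia.
Qed.

(** The dimension bound with no columns excludes nonzero vectors, and an image containing the origin
    would contain them all. *)
Lemma phi_bot : phi (PC0 R n) = PC0 R n.
Proof.
apply: PC_eq => [|v []//].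
have nz v : phi (PC0 R n) v -> v = 0.
  move=> v0; apply: contrapT => /eqP vn0.
  have X0f : colfree (0 : 'M[R]_(n, 0)) by apply/colfreeP => a _; exact: flatmx0.
  apply: (@phi_hull_cols_dim (n - 2) 0 1 0 v _ _ X0f (colfree1 vn0)) => //; first lia.
  rewrite cols1 => _ ->; apply: phi_mono v0; exact: PC0_sub.
move=> v v0; have [x /eqP x0] := exists_neq0 R (ltnW n_gt1).
by case: x0; apply: (nz x); apply: PC_0; rewrite -(nz v v0).
Qed.

Definition thin x := forall p q, phi (ray x) p -> phi (ray x) q -> ~ indep2 p q.

Lemma ray_thin_gt2 x : (2 < n)%N -> x != 0 -> thin x.
Proof.
move=> n2 x0 p q xp xq pq.
apply: (@phi_hull_cols_dim (n - 3) 1 2 x (row_mx p q) _ _ (colfree1 x0) (indep2_colfree pq)) => //.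
  lia.
by have -> := cols_rcons p q; rewrite !cols1 subUset; split=> _ ->.
Qed.

Lemma phi_meet_disjoint K L v : PC_meet K L `<=` PC0 R n -> phi K v -> phi L v -> False.
Proof. by move=> KL Kv Lv; have := phi_meet_sub KL Kv Lv; rewrite phi_bot. Qed.

Lemma phi_ray_n0 x : x != 0 -> ~ phi (ray x) 0.
Proof.
move=> x0 px0; have /phi_order_embedding Tx : phi (PCT R n) `<=` phi (ray x).
  by move=> v _; exact: PC_0.
have [//|l l1 /esym/eqP] := (mem_ray 0 x0).1 (Tx 0 _).
by rewrite scaler_eq0 (negbTE x0) orbF => /eqP l0; lra.
Qed.

(* When n = 2, uncountably many disjoint images cannot all have interior. *)
Lemma exists_thin_split x w : n = 2 -> indep2 x w -> exists s : R,
  0 < s /\ forall a, 0 < a -> thin (a *: (2^-1 *: x + s *: w)) /\ thin (a *: (2^-1 *: x - s *: w)).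
Proof.
move=> n2 xw; apply: contrapT => H.
(* [expR t] runs through uncountably many positive [s]; the colour [c] marks which of the two
   vectors has a multiple that is not thin. *)
pose y (c : bool) (t : R) := 2^-1 *: x + (-1) ^+ c * expR t *: w.
have yy c t t' : t != t' -> indep2 (y c t) (y c t').
  move=> tt'; apply: indep2_lin => //.
  rewrite mulrC -mulrBl mulf_neq0 ?invr_neq0 ?pnatr_eq0 // -mulrBr mulf_neq0 ?signr_eq0 //.
  by rewrite subr_eq0 (inj_eq (@expR_inj R)) eq_sym.
have y0 c t : y c t != 0.
  apply/(indep2_neq0l (yy c t (t + 1) _)).
  by rewrite -subr_eq0 opprD addrA subrr sub0r oppr_eq0 oner_eq0.
have /boolp.choice [s Hs] t : exists s : V * R * bool * R,
    [/\ phi (ray (s.2 *: y s.1.2 t)) s.1.1.1, 0 < s.1.1.2, 0 < s.2 &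
      forall z, `|z - s.1.1.1| < s.1.1.2 -> phi (ray (s.2 *: y s.1.2 t)) z].
  have [c [a [a0 nthin]]] : exists c a, 0 < a /\ ~ thin (a *: y c t).
    apply: contrapT => H'; apply: H; exists (expR t); split=> [|a a0]; first exact: expR_gt0.
    split; apply: contrapT => nt; apply: H'.
      by exists false, a; rewrite /y expr0 mul1r.
    by exists true, a; rewrite /y expr1 mulN1r scaleNr.
  have [p [q [yp yq pq]]] : exists p q, [/\ phi (ray (a *: y c t)) p,
      phi (ray (a *: y c t)) q & indep2 p q].
    apply: contrapT => H'; apply: nthin => p q yp yq pq; apply: H'; by exists p, q.
  have pqf := indep2_colfree pq.
  have [//||//|p' [r [yp' _ r0 rp']]] :=
    @relative_interior_point R n set0 (phi (ray (a *: y c t))) _ _ p _ (@closed0 _) pqf _ yp.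
    by have -> := cols_rcons p q; rewrite !cols1 subUset; split=> _ ->.
  exists (p', r, c, a); split=> //= z zp; apply: rp' => //.
  by apply: colfree_square pqf; rewrite n2.
have s0 t : 0 < (s t).1.1.2 by case: (Hs t).
have [t [t' [tt' ctt' ptt']]] :=
  close_pair (fun t => (s t).1.1.1) (fun t => (s t).1.2) s0.
have [p1 _ a0 H1] := Hs t; have [p2 _ a0' _] := Hs t'.
apply: (@phi_meet_disjoint (ray ((s t).2 *: y (s t).1.2 t))
  (ray ((s t').2 *: y (s t').1.2 t')) _ _ (H1 _ ptt') p2).
rewrite rays_disjoint // ctt'; apply: indep2Z; rewrite ?gt_eqF //; exact: yy.
Qed.

(** A point [c *: p] with [c <= 0] would put the origin into the image, so all points are positive
    multiples of [p]. As the image is closed, the infimum of the factors is attained and starts the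
    ray. *)
Lemma thin_ray x : x != 0 -> thin x -> exists2 p, p != 0 & phi (ray x) = ray p.
Proof.
move=> x0 tx; have [p [xp _]] := phi_ray_nbot x0.
have n0 := phi_ray_n0 x0.
have p0 : p != 0 by apply/eqP => p0; apply: n0; rewrite -p0.
have mult q : phi (ray x) q -> exists2 c, 0 < c & q = c *: p.
  move=> xq; have [/(tx p q xp xq)//|[c qc]] := indep2_or_multiple q p0.
  exists c => //; rewrite ltNge; apply/negP => c0; apply: n0.
  have c1 : 0 < 1 - c by lra.
  have -> : 0 = (- c / (1 - c)) *: p + (1 / (1 - c)) *: q.
    by rewrite qc scalerA -scalerDl mulrAC mul1r mulNr addNr scale0r.
  apply: PC_comb => //; rewrite ?divr_ge0 ?oppr_ge0 //; try exact: ltW.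
  by rewrite -mulrDl addrC mulfV // gt_eqF.
pose C := [set c : R | phi (ray x) (c *: p)].
have C0 : has_inf C.
  split; first by exists 1; rewrite /C /= scale1r.
  exists 0 => c /mult [d d0 /eqP].
  by rewrite -subr_eq0 -scalerBl scaler_eq0 (negbTE p0) orbF subr_eq0 => /eqP ->; exact: ltW.
have xc : phi (ray x) (inf C *: p).
  apply: contrapT => nc.
  have [d [d0 _ dA]] := closed_notin_segment p (@PC_closed _ _ (phi (ray x))) nc.
  have [c Cc cd] := inf_adherent d0 C0.
  apply: (dA (c - inf C)); last by rewrite -scalerDl addrC subrK.
  rewrite subr_ge0 (ge_inf C0.2 Cc) /=; lra.
have c0 : 0 < inf C.
  have [d d0 /eqP] := mult _ xc.
  by rewrite -subr_eq0 -scalerBl scaler_eq0 (negbTE p0) orbF subr_eq0 => /eqP ->.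
exists (inf C *: p); first by rewrite scaler_eq0 (negbTE p0) orbF gt_eqF.
apply: PC_eq; last exact/ray_subE.
move=> q xq; have [c _ qc] := mult q xq; rewrite qc; apply: ray_scale => //.
by apply: ge_inf => //; [exact: C0.2|rewrite /C /= -qc].
Qed.

(** On a common half-line the images would meet, though the rays are disjoint; on opposite
    half-lines they would join to the whole space, though the join of the rays omits the origin. *)
Lemma phi_ray_indep2 x y p q : indep2 x y -> phi (ray x) = ray p -> phi (ray y) = ray q ->
  indep2 p q.
Proof.
move=> xy xp yq.
have p0 : p != 0.
  by apply/eqP => p0; apply: (phi_ray_n0 (indep2_neq0l xy)); rewrite xp -p0; exact: ray_id.
have q0 : q != 0.
  by apply/eqP => q0; apply: (phi_ray_n0 (indep2_neq0r xy)); rewrite yq -q0; exact: ray_id.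
have nopos c : 0 < c -> q != c *: p.
  move=> c0; apply/eqP => qp.
  have [c1|c1] := leP 1 c.
    apply: (@phi_meet_disjoint (ray x) (ray y) (c *: p)).
    - by rewrite rays_disjoint.
    - by have := ray_scale (x := p) ltr01 c1; rewrite scale1r xp.
    - by rewrite yq qp; exact: ray_id.
  apply: (@phi_meet_disjoint (ray x) (ray y) p).
  - by rewrite rays_disjoint.
  - by rewrite xp; exact: ray_id.
  - by have := ray_scale (x := p) c0 (ltW c1); rewrite scale1r yq qp.
have noneg c : 0 < c -> q != - c *: p.
  move=> c0; apply/eqP => qp.
  have /phi_order_embedding : phi (PCT R n) `<=` phi (PC_join (ray x) (ray y)).
    by rewrite phiU xp yq qp => v _; exact: join_opp_ray.
  move=> /(_ 0 I) /(mem_join2 _ xy) [a [b [a0 b0 ab /esym/xy [a00 b00]]]].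
  by rewrite a00 b00 addr0 ler10 in ab.
have [//|[c qp]] := indep2_or_multiple q p0; exfalso.
have [c0|c0|c0] := ltgtP 0 c.
- by have := nopos _ c0; rewrite -qp eqxx.
- by have := noneg (- c); rewrite opprK -qp eqxx oppr_gt0 => /(_ c0).
- by move: q0; rewrite qp -c0 scale0r eqxx.
Qed.

Lemma phi_ray_multiple x p q (a b : R) : 0 < a -> a <= b -> p != 0 ->
  phi (ray (a *: x)) = ray p -> phi (ray (b *: x)) = ray q ->
  exists2 c, 1 <= c & q = c *: p.
Proof.
move=> a0 ab p0 xp xq; apply/(mem_ray _ p0); rewrite -xp.
have : phi (ray (b *: x)) q by rewrite xq; exact: ray_id.
by apply: phi_mono; apply/ray_subE; exact: ray_scale.
Qed.

(* The ray through 2x is cut out of the ray through x by the two simplices on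
   (4y, 4z) and on (8y, 8z/3).  On a 2-dimensional image of the ray through x,
   this forces the images of the two simplices to have the same far edge. *)
Lemma thin_sum y z : indep2 y z ->
  (forall a, 0 < a -> thin (a *: y) /\ thin (a *: z)) -> thin (y + z).
Proof.
move=> yz thinyz p q xp xq pq; set x := y + z in xp xq.
have im v a : v != 0 -> 0 < a -> (forall a, 0 < a -> thin (a *: v)) ->
    exists2 p, p != 0 & phi (ray (a *: v)) = ray p.
  move=> v0 a0 vt; apply: thin_ray (vt a a0).
  by rewrite scaler_eq0 (negbTE v0) orbF gt_eqF.
have imy a a0 := @im y a (indep2_neq0l yz) a0 (fun a a0 => (thinyz a a0).1).
have imz a a0 := @im z a (indep2_neq0r yz) a0 (fun a a0 => (thinyz a a0).2).
have [Y0 Y00 y2] := imy 2 (ltr0n R 2); have [Z0 Z00 z2] := imz 2 (ltr0n R 2).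
have h4 : 0 < 4 :> R by lra.
have h8 : 0 < 8 :> R by lra.
have h83 : 0 < 8 / 3 :> R by lra.
have [Y1 _ y4] := imy 4 h4; have [Y2 _ y8] := imy 8 h8.
have [Z1 _ z4] := imz 4 h4; have [Z2 _ z8] := imz (8 / 3) h83.
have [s1 s11 Ys1] := phi_ray_multiple (ltr0n R 2) (ltac:(lra) : 2 <= 4) Y00 y2 y4.
have [s2 s21 Ys2] := phi_ray_multiple (ltr0n R 2) (ltac:(lra) : 2 <= 8) Y00 y2 y8.
have [t1 t11 Zt1] := phi_ray_multiple (ltr0n R 2) (ltac:(lra) : 2 <= 4) Z00 z2 z4.
have [t2 t21 Zt2] := phi_ray_multiple (ltr0n R 2) (ltac:(lra) : 2 <= 8 / 3) Z00 z2 z8.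
have YZ : indep2 Y0 Z0.
  by apply: phi_ray_indep2 y2 z2; apply: indep2Z => //; rewrite pnatr_eq0.
have s10 : 0 < s1 by lra.
have s20 : 0 < s2 by lra.
have t10 : 0 < t1 by lra.
have t20 : 0 < t2 by lra.
pose M1 := PC_join (ray (4 *: y)) (ray (4 *: z)).
pose M2 := PC_join (ray (8 *: y)) (ray ((8 / 3) *: z)).
have M1E : phi M1 = PC_join (ray (s1 *: Y0)) (ray (t1 *: Z0)).
  by rewrite /M1 phiU y4 z4 Ys1 Zt1.
have M2E : phi M2 = PC_join (ray (s2 *: Y0)) (ray (t2 *: Z0)).
  by rewrite /M2 phiU y8 z8 Ys2 Zt2.
have x0 : x != 0.
  apply/eqP => x0; have [] := yz 1 1; first by rewrite !scale1r.
  by move/eqP; rewrite oner_eq0.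
(* The segment from [a *: y] to [b *: z] crosses the ray of [x] at [2 *: x] exactly if
   [1 / a + 1 / b = 1 / 2]. *)
have cut a b : 0 < a -> 0 < b -> a^-1 + b^-1 = 2^-1 ->
    PC_meet (ray x) (PC_join (ray (a *: y)) (ray (b *: z))) `<=` ray (2 *: x) /\
    ray (2 *: x) `<=` PC_join (ray (a *: y)) (ray (b *: z)).
  move=> a0 b0 ab; split; last first.
    apply/ray_subE; rewrite scalerDr; apply/(mem_join2_scaled _ _ yz a0 b0).
    by split; rewrite // -mulrDr ab mulfV ?pnatr_eq0.
  move=> v [/(mem_ray _ x0) [l l1 ->]]; rewrite scalerDr.
  move=> /(mem_join2_scaled _ _ yz a0 b0) [_ _]; rewrite -mulrDr ab => l2.
  by rewrite -scalerDr; apply: ray_scale => //; lra.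
have [cut1 cut1'] : PC_meet (ray x) M1 `<=` ray (2 *: x) /\ ray (2 *: x) `<=` M1.
  by apply: cut => //; lra.
have [cut2 cut2'] : PC_meet (ray x) M2 `<=` ray (2 *: x) /\ ray (2 *: x) `<=` M2.
  by apply: cut => //; lra.
have coords v : phi (ray x) v -> exists u w, [/\ 0 <= u, 0 <= w & v = u *: Y0 + w *: Z0].
  move=> xv; have : phi (PC_join (ray (2 *: y)) (ray (2 *: z))) v.
    apply: phi_mono xv; apply/ray_subE.
    have -> : x = 1 *: y + 1 *: z by rewrite !scale1r.
    by apply/(mem_join2_scaled _ _ yz); rewrite ?ltr0n //; split; lra.
  by rewrite phiU y2 z2 => /(mem_join2 _ YZ) [u [w [u0 w0 _ ->]]]; exists u, w.
(* If [l > l'], dividing [v] by [l < 1] moves it outward onto the edge of [phi M], hence into the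
   image of [ray (2 *: x)] and so of [M'], although it is still short of the edge of [phi M']. *)
have key M M' (s t s' t' u w : R) : 0 < s -> 0 < t -> 0 < s' -> 0 < t' ->
    phi M = PC_join (ray (s *: Y0)) (ray (t *: Z0)) ->
    phi M' = PC_join (ray (s' *: Y0)) (ray (t' *: Z0)) ->
    PC_meet (ray x) M `<=` ray (2 *: x) -> ray (2 *: x) `<=` M' ->
    0 <= u -> 0 <= w -> phi (ray x) (u *: Y0 + w *: Z0) ->
    ~ phi (ray (2 *: x)) (u *: Y0 + w *: Z0) -> u / s + w / t <= u / s' + w / t'.
  move=> s0 t0 s'0 t'0 ME M'E cutM cutM' u0 w0 xv nv.
  set l := u / s + w / t; set l' := u / s' + w / t'.
  rewrite leNgt; apply/negP => ll'.
  have l'0 : 0 <= l' by rewrite addr_ge0 // divr_ge0 // ltW.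
  have l0 : 0 < l by exact: le_lt_trans ll'.
  have l1 : l < 1.
    rewrite ltNge; apply/negP => l1; apply: nv; apply: (phi_meet_sub cutM xv).
    by rewrite ME; apply/mem_join2_scaled.
  have xlv : phi (ray x) ((u / l) *: Y0 + (w / l) *: Z0).
    have -> : (u / l) *: Y0 + (w / l) *: Z0 = l^-1 *: (u *: Y0 + w *: Z0).
      by rewrite scalerDr !scalerA ![_ / l]mulrC.
    by apply: PC_scale xv; rewrite invf_ge1 // ltW.
  have ul0 : 0 <= u / l by rewrite divr_ge0 // ltW.
  have wl0 : 0 <= w / l by rewrite divr_ge0 // ltW.
  have Mlv : phi M ((u / l) *: Y0 + (w / l) *: Z0).
    rewrite ME; apply/mem_join2_scaled => //; split=> //.
    by rewrite ![_ / l / _]mulrAC -mulrDl mulfV // gt_eqF.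
  have := phi_mono cutM' (phi_meet_sub cutM xlv Mlv).
  rewrite M'E => /(mem_join2_scaled _ _ YZ s'0 t'0) [_ _].
  by rewrite ![_ / l / _]mulrAC -mulrDl ler_pdivlMr // mul1r leNgt ll'.
have eqD u w : 0 <= u -> 0 <= w -> phi (ray x) (u *: Y0 + w *: Z0) ->
    ~ phi (ray (2 *: x)) (u *: Y0 + w *: Z0) ->
    u * (s1^-1 - s2^-1) + w * (t1^-1 - t2^-1) = 0.
  move=> u0 w0 xv nv.
  have h1 := key M1 M2 s1 t1 s2 t2 u w s10 t10 s20 t20 M1E M2E cut1 cut2' u0 w0 xv nv.
  have h2 := key M2 M1 s2 t2 s1 t1 u w s20 t20 s10 t10 M2E M1E cut2 cut1' u0 w0 xv nv.
  by lra.
have [p0 xp0 np0] : exists2 p0, phi (ray x) p0 & ~ phi (ray (2 *: x)) p0.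
  apply: contrapT => H.
  have /phi_order_embedding/ray_subE : phi (ray x) `<=` phi (ray (2 *: x)).
    by move=> v xv; apply: contrapT => nv; apply: H; exists v.
  have x20 : 2 *: x != 0 by rewrite scaler_eq0 (negbTE x0) orbF pnatr_eq0.
  move=> /(mem_ray _ x20) [l l1 /eqP]; rewrite scalerA -subr_eq0 -{1}[x]scale1r -scalerBl.
  by rewrite scaler_eq0 (negbTE x0) orbF => /eqP; lra.
have [u0 [w0 [u00 w00 p0E]]] := coords _ xp0.
have E0 := eqD u0 w0 u00 w00; rewrite -p0E in E0; have {}E0 := E0 xp0 np0.
have p0n0 : p0 != 0 by apply/eqP => p00; apply: (phi_ray_n0 x0); rewrite -p00.
(* The equation extends to all of [phi (ray x)]: a segment from [p0] stays outside the closed image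
   of [ray (2 *: x)] for a while, and a linear form vanishing at two points of a line vanishes on
   it. *)
have D0 u w : phi (ray x) (u *: Y0 + w *: Z0) -> 0 <= u -> 0 <= w ->
    u * (s1^-1 - s2^-1) + w * (t1^-1 - t2^-1) = 0.
  move=> xq' u1 w1; set q' := u *: Y0 + w *: Z0 in xq'.
  have [d [d0 d1 dA]] :=
    closed_notin_segment (q' - p0) (@PC_closed _ _ (phi (ray (2 *: x)))) np0.
  have E : p0 + d *: (q' - p0) = ((1 - d) * u0 + d * u) *: Y0 + ((1 - d) * w0 + d * w) *: Z0.
    rewrite /q' p0E; apply/matrixP => i j; rewrite !mxE; ring.
  have := dA d; rewrite lexx (ltW d0) E => /(_ isT) nd.
  have d1' : 0 <= 1 - d by lra.
  have d0' := ltW d0.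
  have := eqD _ _ _ _ _ nd; rewrite !addr_ge0 ?mulr_ge0 // => /(_ isT isT).
  have xd : phi (ray x) (p0 + d *: (q' - p0)).
    have -> : p0 + d *: (q' - p0) = (1 - d) *: p0 + d *: q'.
      by rewrite scalerBr scalerBl scale1r addrA addrAC.
    by apply: PC_comb => //; lra.
  rewrite -E => /(_ xd) E1.
  apply: (mulfI (lt0r_neq0 d0)); rewrite mulr0.
  set D := _ - _ in E0 E1 *; set D' := t1^-1 - _ in E0 E1 *; nra.
have [u1 [w1 [u10 w10 pE]]] := coords _ xp; have [u2 [w2 [u20 w20 qE]]] := coords _ xq.
have E1 := D0 u1 w1; rewrite -pE in E1; have {}E1 := E1 xp u10 w10.
have E2 := D0 u2 w2; rewrite -qE in E2; have {}E2 := E2 xq u20 w20.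
(* A linear equation with two independent solutions has zero coefficients. *)
have s12 : s1 = s2.
  apply: invr_inj; apply/eqP; rewrite -subr_eq0; apply/eqP.
  set D := _ - _ in E1 E2 *; set D' := t1^-1 - _ in E1 E2.
  apply: contrapT => /eqP Dn0.
  have : (u1 * w2 - u2 * w1) * D = 0 by nra.
  move=> /eqP; rewrite mulf_eq0 (negbTE Dn0) orbF => /eqP det.
  have [] := pq w2 (- w1).
    rewrite pE qE; apply/matrixP => i j; rewrite !mxE.
    have -> : w2 * (u1 * Y0 i j + w1 * Z0 i j) + - w1 * (u2 * Y0 i j + w2 * Z0 i j) =
      (u1 * w2 - u2 * w1) * Y0 i j by ring.
    by rewrite det mul0r.
  move=> w2E /eqP; rewrite oppr_eq0 => /eqP w1E; rewrite w1E mul0r addr0 in E1.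
  move: E1 => /eqP; rewrite mulf_eq0 (negbTE Dn0) orbF => /eqP u1E.
  by have := indep2_neq0l pq; rewrite pE u1E w1E !scale0r addr0 eqxx.
have /phi_order_embedding/ray_subE : phi (ray (4 *: y)) `<=` phi (ray (8 *: y)).
  by rewrite y4 y8 Ys1 Ys2 s12.
have y80 : 8 *: y != 0 by rewrite scaler_eq0 (negbTE (indep2_neq0l yz)) orbF pnatr_eq0.
move=> /(mem_ray _ y80) [l l1 /eqP]; rewrite scalerA -subr_eq0 -scalerBl.
by rewrite scaler_eq0 (negbTE (indep2_neq0l yz)) orbF => /eqP; lra.
Qed.

Lemma ray_thin x : x != 0 -> thin x.
Proof.
move=> x0; have [n2|] := ltnP 2 n; first exact: ray_thin_gt2.
rewrite leq_eqVlt ltnNge n_gt1 orbF => /eqP n2.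
have [w xw] := exists_indep2 n_gt1 x0.
have [s [s0 Hs]] := exists_thin_split n2 xw.
have -> : x = (2^-1 *: x + s *: w) + (2^-1 *: x - s *: w).
  rewrite addrACA subrr addr0 -scalerDl -mulr2n -[2^-1]mulr1 -mulrnAr.
  by rewrite mulVf ?pnatr_eq0 // scale1r.
apply: thin_sum Hs; rewrite -scaleNr; apply: indep2_lin => //.
rewrite mulrN -opprD oppr_eq0 mulrC -mulrDr mulf_neq0 ?gt_eqF //; lra.
Qed.

Lemma phi_ray_ex x : x != 0 -> exists2 p, p != 0 & phi (ray x) = ray p.
Proof. by move=> x0; apply: thin_ray x0 (ray_thin x0). Qed.

(** * Linearity of the induced point map *)

Section PointMap.

Variable F : V -> V.
Hypothesis F_neq0 : forall x, x != 0 -> F x != 0.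
Hypothesis F_ray : forall x, x != 0 -> phi (ray x) = ray (F x).

Lemma F_inj x y : x != 0 -> y != 0 -> F x = F y -> x = y.
Proof.
move=> x0 y0 xy; have E : phi (ray x) = phi (ray y) by rewrite !F_ray // xy.
have /phi_order_embedding/ray_subE/(mem_ray _ y0) [l l1 xl] : phi (ray x) `<=` phi (ray y).
  by rewrite E.
have /phi_order_embedding/ray_subE/(mem_ray _ x0) [m m1 ym] : phi (ray y) `<=` phi (ray x).
  by rewrite E.
have /eqP : (m * l - 1) *: y = 0.
  by rewrite scalerBl -scalerA -xl -ym scale1r subrr.
rewrite scaler_eq0 (negbTE y0) orbF => /eqP ml1.
have l1' : l = 1 by nra.
by rewrite xl l1' scale1r.
Qed.

Lemma F_indep2 x y : indep2 x y -> indep2 (F x) (F y).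
Proof.
move=> xy; apply: (phi_ray_indep2 xy); apply: F_ray.
  exact: indep2_neq0l xy.
exact: indep2_neq0r xy.
Qed.

Lemma F_expand x (t : R) : x != 0 -> 1 < t -> exists2 m, 1 < m & F (t *: x) = m *: F x.
Proof.
move=> x0 t1; have tx0 : t *: x != 0 by rewrite scaler_eq0 (negbTE x0) orbF gt_eqF //; lra.
have [||m m1 E] := @phi_ray_multiple x (F x) (F (t *: x)) 1 t ltr01 (ltW t1) (F_neq0 x0).
- by rewrite scale1r F_ray.
- by rewrite F_ray.
exists m => //; rewrite lt_neqAle m1 andbT; apply/eqP => m1'.
have := F_inj tx0 x0; rewrite E -m1' scale1r => /(_ erefl)/eqP.
rewrite -subr_eq0 -{2}[x]scale1r -scalerBl scaler_eq0 (negbTE x0) orbF => /eqP; lra.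
Qed.

Lemma F_multiple x (t : R) : x != 0 -> 0 < t -> exists2 m, 0 < m & F (t *: x) = m *: F x.
Proof.
move=> x0 t0; have tx0 : t *: x != 0 by rewrite scaler_eq0 (negbTE x0) orbF gt_eqF.
have [t1|t1|->] := ltgtP t 1; last by exists 1; rewrite ?scale1r.
  have it1 : 1 < t^-1 by rewrite invf_gt1.
  have [m m1] := F_expand tx0 it1; rewrite scalerA mulVf ?gt_eqF // scale1r => ->.
  by exists m^-1; rewrite ?invr_gt0 ?scalerA ?mulVf ?scale1r // ?gt_eqF //; lra.
by have [m m1 ->] := F_expand x0 t1; exists m => //; lra.
Qed.

(** The join gives [p + q >= 1]. If [p + q > 1], some [F z / l] with [l > 1] would lie in the images
    of [ray (z / 2)] and of the join, whose meet is inside [ray z]; but [F z] starts its ray. Zero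
    coefficients contradict injectivity. *)
Lemma F_segment x y (a b : R) : indep2 x y -> 0 < a -> 0 < b -> a + b = 1 ->
  exists p q : R, [/\ 0 < p, 0 < q, p + q = 1 & F (a *: x + b *: y) = p *: F x + q *: F y].
Proof.
move=> xy a0 b0 ab; set z := _ + _.
have zE t : t *: z = (t * a) *: x + (t * b) *: y by rewrite scalerDr !scalerA.
have z0 : z != 0.
  by apply/eqP => /xy [a00 _]; rewrite a00 ltxx in a0.
have Fxy := F_indep2 xy.
have xn0 := indep2_neq0l xy; have yn0 := indep2_neq0r xy.
have phij : phi (PC_join (ray x) (ray y)) = PC_join (ray (F x)) (ray (F y)).
  by rewrite phiU !F_ray.
have [p [q [p0 q0 pq Fz]]] : exists p q : R,
    [/\ 0 <= p, 0 <= q, 1 <= p + q & F z = p *: F x + q *: F y].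
  apply/(mem_join2 _ Fxy); rewrite -phij.
  have : phi (ray z) (F z) by rewrite F_ray //; exact: ray_id.
  apply: phi_mono; apply/ray_subE/(mem_join2 _ xy); exists a, b.
  by split; rewrite ?ab // ltW.
have pq1 : p + q = 1.
  apply/eqP; rewrite eq_le pq andbT leNgt; apply/negP => pq1.
  pose z2 := 2^-1 *: z.
  have z20 : z2 != 0 by rewrite scaler_eq0 (negbTE z0) orbF invr_eq0 pnatr_eq0.
  have [c c1 Fzc] : exists2 c, 1 < c & F z = c *: F z2.
    have := F_expand z20 (ltac:(lra) : 1 < 2).
    by rewrite /z2 scalerA mulfV ?pnatr_eq0 // scale1r.
  have [l [l1 lc lpq]] : exists l : R, [/\ 1 < l, l <= c & l <= p + q].
    by exists (Num.min c (p + q)); rewrite lt_min c1 pq1 !ge_min !lexx orbT.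
  have l0 : 0 < l by lra.
  have : phi (ray z) (l^-1 *: F z).
    apply: (@phi_meet_sub (ray z2) (PC_join (ray x) (ray y))).
    - move=> v [/(mem_ray _ z20) [k k1 ->]]; rewrite /z2 scalerA zE.
      move=> /(mem_join2 _ xy) [s [t [s0 t0 st /(indep2_eq xy) [sE tE]]]].
      rewrite -zE; have := ray_scale (x := z) ltr01 (l := k / 2); rewrite scale1r; apply; nra.
    - rewrite F_ray // Fzc scalerA mulrC -[X in ray X](scale1r (F z2)).
      by apply: ray_scale; rewrite // ler_pdivlMr // mul1r.
    - rewrite phij Fz scalerDr !scalerA; apply/(mem_join2 _ Fxy).
      exists (l^-1 * p), (l^-1 * q); split; rewrite ?mulr_ge0 ?invr_ge0 ?(ltW l0) //.
      by rewrite -mulrDr mulrC ler_pdivlMr // mul1r.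
  rewrite F_ray // => /(mem_ray _ (F_neq0 z0)) [k k1 /eqP].
  rewrite -subr_eq0 -scalerBl scaler_eq0 (negbTE (F_neq0 z0)) orbF subr_eq0 => /eqP lk.
  have l1' : l^-1 < 1 by rewrite invf_lt1.
  by lra.
exists p, q; split=> //.
- rewrite lt_neqAle p0 andbT; apply/eqP => p00.
  have zy : z = y by apply: F_inj => //; rewrite Fz -p00 scale0r add0r -[q]add0r {1}p00 pq1 scale1r.
  have [] := @indep2_eq _ _ x y a b 0 1 xy; last by move=> a00; rewrite a00 ltxx in a0.
  by rewrite scale0r scale1r add0r; exact: zy.
- rewrite lt_neqAle q0 andbT; apply/eqP => q00.
  have zx : z = x by apply: F_inj => //; rewrite Fz -q00 scale0r addr0 -[p]addr0 {1}q00 pq1 scale1r.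
  have [] := @indep2_eq _ _ x y a b 1 0 xy; last by move=> _ b00; rewrite b00 ltxx in b0.
  by rewrite scale0r scale1r addr0; exact: zx.
Qed.

(** Every [F y] lies in the join of the rays of [F (t *: x)] and [F (t *: - x)]. For independent
    [F x] and [F (- x)], the join at [t = 2] misses [F x]; for a positive multiple, the join at
    [t = 1] is inside one ray and misses [F y] with [y] independent of [x]. *)
Lemma F_opp x : x != 0 -> exists2 c, 0 < c & F (- x) = - c *: F x.
Proof.
move=> x0; have nx0 : - x != 0 by rewrite oppr_eq0.
have inT v : phi (PCT R n) v -> forall t, 0 < t ->
    PC_join (ray (F (t *: x))) (ray (F (t *: - x))) v.
  move=> Tv t t0; have tx0 : t *: x != 0 by rewrite scaler_eq0 (negbTE x0) orbF gt_eqF.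
  rewrite scalerN -!F_ray ?oppr_eq0 // -phiU.
  by apply: phi_mono Tv; exact: PCT_sub_join_opp.
have FT y : y != 0 -> phi (PCT R n) (F y).
  move=> y0; have : phi (ray y) (F y) by rewrite F_ray //; exact: ray_id.
  by apply: phi_mono.
have [ind|[c Fc]] := indep2_or_multiple (F (- x)) (F_neq0 x0).
  have [m m1 mE] := F_expand x0 (ltac:(lra) : 1 < 2).
  have [m' m1' mE'] := F_expand nx0 (ltac:(lra) : 1 < 2).
  have [m0 m'0] : 0 < m /\ 0 < m' by split; lra.
  have : PC_join (ray (m *: F x)) (ray (m' *: F (- x))) (1 *: F x + 0 *: F (- x)).
    by rewrite -mE -mE' scale1r scale0r addr0; apply: inT; rewrite ?ltr0n //; exact: FT.
  move=> /(mem_join2_scaled _ _ ind m0 m'0) [_ _]; rewrite mul0r addr0 mul1r => im1.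
  have im1' : m^-1 < 1 by rewrite invf_lt1.
  by lra.
have [c0|c0|c0] := ltgtP 0 c.
- have [y xy] := exists_indep2 n_gt1 x0.
  have := inT _ (FT y (indep2_neq0r xy)) 1 ltr01; rewrite !scale1r Fc.
  have : PC_join (ray (F x)) (ray (c *: F x)) `<=` ray (Num.min 1 c *: F x).
    have mc0 : 0 < Num.min 1 c by rewrite lt_min ltr01.
    apply/join_subE; split; apply/ray_subE.
      by have := ray_scale (x := F x) mc0 (l := 1); rewrite scale1r ge_min lexx; apply.
    by apply: ray_scale => //; rewrite ge_min lexx orbT.
  move=> /[apply]; have mF0 : Num.min 1 c *: F x != 0.
    by rewrite scaler_eq0 (negbTE (F_neq0 x0)) orbF gt_eqF // lt_min ltr01.
  move=> /(mem_ray _ mF0) [l l1]; rewrite scalerA => FyE.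
  have [] := @F_indep2 _ _ xy (l * Num.min 1 c) (-1); first by rewrite FyE scaleN1r subrr.
  by move=> _ /eqP; rewrite oppr_eq0 oner_eq0.
- by exists (- c); rewrite ?oppr_gt0 // opprK.
- by have := F_neq0 nx0; rewrite Fc -c0 scale0r eqxx.
Qed.

(* G v records how F acts on the line through v. *)
Lemma F_sum x y (G : V -> R -> R) :
  (forall v t, v != 0 -> 0 < t -> 0 < G v t /\ F (t^-1 *: v) = (G v t)^-1 *: F v) ->
  indep2 x y -> exists p q : R, [/\ 0 < p, 0 < q, F (x + y) = p *: F x + q *: F y &
    forall a b, 0 < a -> 0 < b -> G (x + y) (a + b) = p * G x a + q * G y b].
Proof.
move=> GE xy; have x0 := indep2_neq0l xy; have y0 := indep2_neq0r xy.
have xy0 : x + y != 0.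
  apply/eqP => xy0; have [] := xy 1 1; first by rewrite !scale1r.
  by move/eqP; rewrite oner_eq0.
have t20 : 2 != 0 :> R by rewrite pnatr_eq0.
have [p [q [p0 q0 FE]]] : exists p q : R, [/\ 0 < p, 0 < q & F (x + y) = p *: F x + q *: F y].
  have [|||p [q [p0 q0 _]]] := @F_segment _ _ 2^-1 2^-1 (indep2Z t20 t20 xy).
  - by rewrite invr_gt0.
  - by rewrite invr_gt0.
  - lra.
  rewrite !scalerA mulVf // !scale1r => ->.
  have [m m0 ->] := F_multiple x0 (ltr0n R 2); have [m' m'0 ->] := F_multiple y0 (ltr0n R 2).
  by exists (p * m), (q * m'); rewrite !mulr_gt0 // !scalerA.
exists p, q; split=> // a b a0 b0.
have ab0 : 0 < a + b by rewrite addr_gt0.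
have [Gx Fx] := GE x a x0 a0; have [Gy Fy] := GE y b y0 b0.
have [Gz Fz] := GE (x + y) (a + b) xy0 ab0.
have ab : indep2 (a^-1 *: x) (b^-1 *: y) by apply: indep2Z; rewrite ?invr_eq0 ?gt_eqF.
(* [(x + y) / (a + b)] divides the segment from [x / a] to [y / b]; [p' + q' = 1] yields the
   equation. *)
have [|||p' [q' [p'0 q'0 pq']]] := @F_segment _ _ (a / (a + b)) (b / (a + b)) ab.
- by rewrite divr_gt0.
- by rewrite divr_gt0.
- by rewrite -mulrDl mulfV // gt_eqF.
rewrite !scalerA ![_ / (a + b) / _]mulrAC !mulfV ?gt_eqF // !mul1r -scalerDr Fz Fx Fy FE.
rewrite scalerDr !scalerA => /(indep2_eq (F_indep2 xy)) [E1 E2].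
have {}E1 : p * G x a = p' * G (x + y) (a + b).
  by rewrite -[p](mulVKf (lt0r_neq0 Gz)) E1; field; exact: lt0r_neq0.
have {}E2 : q * G y b = q' * G (x + y) (a + b).
  by rewrite -[q](mulVKf (lt0r_neq0 Gz)) E2; field; exact: lt0r_neq0.
by rewrite E1 E2 -mulrDl pq' mul1r.
Qed.

Lemma F_scale_pos x (t : R) : x != 0 -> 0 < t -> F (t *: x) = t *: F x.
Proof.
suff [G [GE GI]] : exists G : V -> R -> R,
    (forall v t, v != 0 -> 0 < t -> 0 < G v t /\ F (t^-1 *: v) = (G v t)^-1 *: F v) /\
    forall v t, v != 0 -> 0 < t -> G v t = t.
  move=> x0 t0; have it0 : 0 < t^-1 by rewrite invr_gt0.
  by have [_] := GE x t^-1 x0 it0; rewrite GI // !invrK.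
have /boolp.choice [g gE] (vt : V * R) : exists g, vt.1 != 0 -> 0 < vt.2 ->
    0 < g /\ F (vt.2^-1 *: vt.1) = g^-1 *: F vt.1.
  have [v0|v0] := eqVneq vt.1 0; first by exists 0 => /eqP [].
  have [t0|t0] := ltP 0 vt.2; last by exists 0.
  have it0 : 0 < vt.2^-1 by rewrite invr_gt0.
  have [m m0 mE] := F_multiple v0 it0; exists m^-1 => _ _.
  by rewrite invrK invr_gt0.
pose G v t := g (v, t); exists G.
have GE v s : v != 0 -> 0 < s -> 0 < G v s /\ F (s^-1 *: v) = (G v s)^-1 *: F v.
  exact: (gE (v, s)).
split=> // y s y0; have [x' yx'] := exists_indep2 n_gt1 y0.
have xy := indep2_sym yx'; have x'0 := indep2_neq0l xy.
have xyy : indep2 (x' + y) (- y).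
  have := @indep2_lin R n x' y 1 1 0 (-1) xy; rewrite !scale1r scale0r add0r scaleN1r.
  by apply; rewrite mulr0 subr0 mul1r oppr_eq0 oner_eq0.
have ny0 := indep2_neq0r xyy.
have [p [q [p0 q0 FE GD]]] := F_sum GE xy.
have [p' [q' [p'0 q'0]]] := F_sum GE xyy; rewrite addrK => FE' GD'.
(* Adding [y] and then [- y] returns to [x'], so the coefficients at [F x'] multiply to 1. *)
have pp' : p * p' = 1.
  have [c c0 Fy] := F_opp y0.
  have [] := @indep2_eq _ _ (F x') (F y) 1 0 (p * p') (p' * q - q' * c) (F_indep2 xy); last by [].
  rewrite scale1r scale0r addr0 {1}FE' FE Fy scalerDr !scalerA -addrA -scalerDl.
  by rewrite mulrN [p' * p]mulrC.
have [k kE] : exists k, forall c, 0 < c -> q * G y c = k * c.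
  apply: (@pexider_pos_linear R (fun a => p * G x' a) _ (fun b => p * q' * G (- y) b)).
  - by move=> c c0; rewrite mulr_gt0 //; case: (GE y c y0 c0).
  - by move=> c c0; rewrite !mulr_gt0 //; case: (GE (- y) c ny0 c0).
  - move=> a b c a0 b0 c0; rewrite addrAC GD' ?addr_gt0 // GD //.
    by rewrite mulrDr !mulrA pp' mul1r.
have [g0 g1] := GE y 1 y0 ltr01; rewrite invr1 scale1r in g1.
have Gy1 : G y 1 = 1.
  have /eqP : (1 - (G y 1)^-1) *: F y = 0 by rewrite scalerBl scale1r -g1 subrr.
  rewrite scaler_eq0 (negbTE (F_neq0 y0)) orbF subr_eq0 => /eqP e1.
  by apply: invr_inj; rewrite -e1 invr1.
move=> s0; have := kE s s0; have := kE 1 ltr01; rewrite Gy1 !mulr1 => <-.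
exact/mulfI/lt0r_neq0.
Qed.

Lemma F_add_indep2 x y : indep2 x y -> F (x + y) = F x + F y.
Proof.
move=> xy; have [v t v0 t0|p [q [p0 q0 FE GD]]] := @F_sum x y (fun _ t => t) _ xy.
  by split=> //; apply: F_scale_pos; rewrite ?invr_gt0.
(* The two instances read [p + q = 2] and [2 p + q = 3]. *)
have := GD 1 1 ltr01 ltr01; have := GD 2 1 (ltr0n R 2) ltr01 => E1 E2.
have [p1 q1] : p = 1 /\ q = 1 by split; lra.
by rewrite FE p1 q1 !scale1r.
Qed.

Lemma F_oppE x : x != 0 -> F (- x) = - F x.
Proof.
move=> x0; have [y xy] := exists_indep2 n_gt1 x0.
have yxx : indep2 (y + x) (- x).
  have := @indep2_lin R n y x 1 1 0 (-1) (indep2_sym xy).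
  rewrite !scale1r scale0r add0r scaleN1r; apply.
  by rewrite mulr0 subr0 mul1r oppr_eq0 oner_eq0.
have := F_add_indep2 yxx; rewrite addrK F_add_indep2; last exact: indep2_sym.
by move/eqP; rewrite -addrA -subr_eq0 opprD addrA subrr sub0r oppr_eq0 addrC addr_eq0 => /eqP.
Qed.

Hypothesis F0 : F 0 = 0.

Lemma F_scale x (t : R) : F (t *: x) = t *: F x.
Proof.
have [->|x0] := eqVneq x 0; first by rewrite F0 !scaler0 F0.
have [t0|t0|->] := ltgtP t 0; last by rewrite !scale0r F0.
  have nt0 : 0 < - t by rewrite oppr_gt0.
  have -> : t *: x = (- t) *: (- x) by rewrite scaleNr scalerN opprK.
  by rewrite F_scale_pos ?oppr_eq0 // F_oppE // scaleNr scalerN opprK.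
exact: F_scale_pos.
Qed.

Lemma F_add x y : F (x + y) = F x + F y.
Proof.
have [->|x0] := eqVneq x 0; first by rewrite F0 !add0r.
have [/F_add_indep2 //|[c ->]] := indep2_or_multiple y x0.
have -> : x + c *: x = (1 + c) *: x by rewrite scalerDl scale1r.
by rewrite !F_scale scalerDl scale1r.
Qed.

Lemma F_matrix : exists2 g : 'M[R]_n, g \in unitmx & forall x, F x = g *m x.
Proof.
pose g : 'M[R]_n := \matrix_(i, j) F (col j 1%:M) i 0.
have gE x : F x = g *m x.
  rewrite -{1}[x]mul1mx !mulmx_col_sum (big_morph F F_add F0).
  apply: eq_bigr => i _; rewrite F_scale; congr (_ *: _).
  by apply/matrixP => a b; rewrite ord1 !mxE.
exists g => //; have : colfree g.
  apply/colfreeP => a; rewrite -gE => Fa0; apply: contrapT => /eqP a0.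
  by have := F_neq0 a0; rewrite Fa0 eqxx.
by rewrite /colfree row_free_unit unitmx_tr.
Qed.

End PointMap.

Lemma phi_linear : exists2 g : 'M[R]_n, g \in unitmx &
  forall K, phi K = [set g *m x | x in K] :> set V.
Proof.
(* [ray 0] is the whole space and determines no vector, so [F 0] is set to 0 as linearity
   demands. *)
have /boolp.choice [F FE] x : exists y, (x = 0 -> y = 0) /\
    (x != 0 -> y != 0 /\ phi (ray x) = ray y).
  have [->|x0] := eqVneq x 0; first by exists 0.
  by have [y y0 xy] := phi_ray_ex x0; exists y; split=> // /eqP; rewrite (negbTE x0).
have F_neq0 x : x != 0 -> F x != 0 by move=> /(FE x).2 [].
have F_ray x : x != 0 -> phi (ray x) = ray (F x) by move=> /(FE x).2 [].
have [g gU gE] := F_matrix F_neq0 F_ray ((FE 0).1 erefl).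
have memE K x : x != 0 -> K x <-> phi K (g *m x).
  move=> x0; rewrite -gE; split=> [Kx|FKx].
    have : phi (ray x) (F x) by rewrite F_ray //; exact: ray_id.
    by apply: phi_mono; exact/ray_subE.
  by apply/ray_subE/phi_order_embedding; rewrite F_ray //; exact/ray_subE.
have invn0 v : v != 0 -> invmx g *m v != 0.
  by apply: contra_neq => v0; rewrite -[v](mulKVmx gU) v0 mulmx0.
exists g => // K; apply/seteqP; split=> [v Kv|_ [x Kx <-]].
- exists (invmx g *m v); last by rewrite mulKVmx.
  (* Containing the origin means being the whole space, which nonzero points detect. *)
  have [v0|v0] := eqVneq v 0; last by apply/memE; rewrite ?mulKVmx // invn0.
  rewrite v0 mulmx0; apply: (@PC_sub_neq0 R n (PCT R n) K (ltnW n_gt1)) => // x x0 _.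
  by apply/memE => //; apply: PC_0; rewrite -v0.
- have [x0|x0] := eqVneq x 0; last exact/(memE K x x0).
  move: Kx; rewrite x0 mulmx0 => K0.
  apply: (@PC_sub_neq0 R n (PCT R n) (phi K) (ltnW n_gt1)) => // v v0 _.
  by rewrite -[v](mulKVmx gU); apply/(memE K _ (invn0 v v0)); exact: PC_0.
Qed.

End Endomorphism.

(** * Constant and linear maps are endomorphisms; the equivalence *)

Lemma PC_meet_id (R : realType) (n : nat) (K : PC R n) : PC_meet K K = K.
Proof. by apply: PC_eq => x; [case|split]. Qed.

Lemma PC_join_id (R : realType) (n : nat) (K : PC R n) : PC_join K K = K.
Proof. by apply: PC_eq; [apply/join_subE; split|exact: sub_joinl]. Qed.

Lemma is_PC_preimage (R : realType) (n : nat) (g : 'M[R]_n) (K : PC R n) :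
  is_PC [set x | K (g *m x)].
Proof.
apply: is_PCI.
- apply/convexE => x y a a01 /= Kx Ky; rewrite mulmxDr -!scalemxAr.
  by have /convexE := @PC_convex R n K; apply.
- have /continuous_closedP := @mulmx_continuous R n n g.
  by move=> /(_ _ (@PC_closed R n K)).
- by rewrite /= mulmx0 => K0; apply/seteqP; split=> // x _ /=; exact: PC_0.
- by move=> x l l1 /=; rewrite -scalemxAr; exact: PC_scale.
Qed.

(** As [g] is bijective, [phi] preserves inclusions and meets. For joins, the preimage of
    [PC_join (phi K) (phi L)] under [g] is a member of the lattice above [K] and [L]. *)
Lemma linear_image_endomorphism (R : realType) (n : nat) (g : 'M[R]_n)
    (phi : PC R n -> PC R n) : g \in unitmx ->
  (forall K : PC R n, phi K = [set g *m x | x in K] :> set 'cV[R]_n) ->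
  forall K L : PC R n, phi (PC_meet K L) = PC_meet (phi K) (phi L) /\
                       phi (PC_join K L) = PC_join (phi K) (phi L).
Proof.
move=> gU phiE K L.
have memE M x : phi M (g *m x) <-> M x.
  rewrite phiE; split=> [[y My gyx]|Mx]; last by exists x.
  by rewrite -[x](mulKmx gU) -gyx mulKmx.
have sub (M M' : PC R n) : M `<=` M' -> phi M `<=` phi M'.
  by move=> MM' v; rewrite -[v](mulKVmx gU) => /memE/MM'/memE.
split; apply: PC_eq.
- by move=> v Mv; split; move: v Mv; apply: sub => x [].
- by move=> v []; rewrite -[v](mulKVmx gU) => /memE Kx /memE Lx; apply/memE.
- move=> v; rewrite -[v](mulKVmx gU) => /memE; move: (invmx g *m v).
  apply: (_ : _ `<=` MkPC (is_PC_preimage g (PC_join (phi K) (phi L)))).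
  apply/join_subE; split=> x Mx.
    by apply: sub_joinl; apply/memE.
  by apply: sub_joinr; apply/memE.
- apply/join_subE; split; apply: sub; [exact: sub_joinl|exact: sub_joinr].
Qed.

Theorem theorem1p3 (R : realType) (n : nat) (hn : (2 <= n)%N)
    (phi : PC R n -> PC R n) :
  (forall K L : PC R n,
     phi (PC_meet K L) = PC_meet (phi K) (phi L) /\
     phi (PC_join K L) = PC_join (phi K) (phi L)) <->
  ((exists C : PC R n, forall K : PC R n, phi K = C) \/
   (exists2 g : 'M[R]_n, g \in unitmx &
      forall K : PC R n, phi K = [set g *m x | x in K] :> set 'cV[R]_n)).
Proof.
split=> [phiE|[[C phiC] K L|[g gU phiE]]]; last exact: linear_image_endomorphism phiE.
- have phiI K L := (phiE K L).1; have phiU K L := (phiE K L).2.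
  (* Every image lies between those of the empty set and the whole space, so [phi] is constant once
     these two coincide. *)
  case: (pselect (phi (PCT R n) `<=` phi (PC0 R n))) => [T0|phiN]; [left|right].
    exists (phi (PC0 R n)) => K; apply: PC_eq; last exact: phi_mono.
    by apply: subset_trans T0; exact: phi_mono.
  exact: phi_linear.
- by rewrite !phiC PC_meet_id PC_join_id.
Qed.
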